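(* Let $\alpha,\beta\in\alpha_0\mathbb{Z}$ with $|\alpha|,|\beta|<\frac1{\sqrt2}$. Then: (i) (adjoint relation, i.e. $(Y_\alpha(w)\otimes Y_\alpha(w^{-1}))^*=Y_{-\alpha}(w)\otimes Y_{-\alpha}(w^{-1})$ under $w^*=w^{-1}$) for all $s\in\mathbb{Z}$ and $\Psi_1,\Psi_2\in\mathcal D$, $\langle\Psi_1,\Phi_{\alpha,s}\Psi_2\rangle=\langle\Phi_{-\alpha,-s}\Psi_1,\Psi_2\rangle$; (ii) (weak commutativity) for all $m,n\in\mathbb{Z}$ and $\Psi_1,\Psi_2\in\mathcal D$, $$\langle\Phi_{-\alpha,-m}\Psi_1,\Phi_{\beta,n}\Psi_2\rangle=\langle\Phi_{-\beta,-n}\Psi_1,\Phi_{\alpha,m}\Psi_2\rangle,$$ i.e. $Y_\alpha(w)\otimes Y_\alpha(w^{-1})$ and $Y_\beta(z)\otimes Y_\beta(z^{-1})$ commute as sesquilinear forms on $\mathcal D$.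
   Context: For $\beta\in\mathbb{R}$ let $\mathcal H_\beta$ be the Hilbert space carrying a unitary representation of the Heisenberg algebra: operators $J_{\beta,n}$, $n\in\mathbb{Z}$, with $[J_{\beta,m},J_{\beta,n}]=m\,\delta_{m+n,0}$, $J_{\beta,n}^*=J_{\beta,-n}$, $J_{\beta,0}=\beta\cdot\mathbf 1$, and a cyclic unit vector $\Omega_\beta$ with $J_{\beta,n}\Omega_\beta=0$ for $n>0$; $\mathcal H_\beta$ is the closure of the span $\mathcal H_\beta^{\rm fin}$ of the vectors $J_{\beta,-n_1}\cdots J_{\beta,-n_k}\Omega_\beta$, $n_i>0$. Fix $\alpha_0\in\mathbb{R}$ with $0<|\alpha_0|\le1$ and set $\hat{\mathcal H}=\bigoplus_{j\in\mathbb{Z}}\mathcal H_{j\alpha_0}$, $\hat J_n=\bigoplus_j J_{j\alpha_0,n}$. For $\alpha\in\alpha_0\mathbb{Z}$ let $c_\alpha$ be the unitary on $\hat{\mathcal H}$ mapping $\mathcal H_\beta\to\mathcal H_{\beta+\alpha}$ by $c_\alpha \hat J_{-n_1}\cdots\hat J_{-n_k}\Omega_\beta=\hat J_{-n_1}\cdots\hat J_{-n_k}\Omega_{\beta+\alpha}$ ($n_i>0$). Define the formal series $E^{\pm}(\alpha,z)=\exp\bigl(\mp\sum_{n>0}\frac{\alpha\hat J_{\pm n}}{n}z^{\mp n}\bigr)$ and $Y_\alpha(z)=c_\alpha E^-(\alpha,z)E^+(\alpha,z)z^{\alpha\hat J_0}$, where $z^{\alpha\hat J_0}$ acts as $z^{\alpha\beta}$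 on $\mathcal H_\beta$. With $d=\alpha^2/2$ write $Y_\alpha(z)=\sum_{s\in\mathbb{R}}Y_{\alpha,s}z^{-s-d}$; the coefficient $Y_{\alpha,s}$ is a bounded operator (for $|\alpha|\le1$) mapping $\mathcal H_\beta$ into $\mathcal H_{\beta+\alpha}$, nonzero on $\mathcal H_\beta$ only for $s\in\mathbb{Z}-\alpha\beta-d$. The domain $\mathcal D$ is the algebraic direct sum $\bigoplus_{j\in\mathbb{Z},\mathrm{alg}}\mathcal H^{\rm fin}_{j\alpha_0}\otimes_{\mathrm{alg}}\mathcal H^{\rm fin}_{j\alpha_0}$. For $|\alpha|<1/\sqrt2$ and $s\in\mathbb{Z}$, $\Phi_{\alpha,s}$ denotes the operator on $\mathcal D$ given by the norm-convergent series $\Phi_{\alpha,s}\Psi=\sum_{t\in\mathbb{R}}(Y_{\alpha,t}\otimes Y_{\alpha,t-s})\Psi$; it is the coefficient of $w^{-s}$ in the formal series $Y_\alpha(w)\otimes Y_\alpha(w^{-1})$. *)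

(* Defs.v *)
From Stdlib Require Import Reals ZArith List ClassicalEpsilon.
From Coquelicot Require Import Coquelicot.
From mathcomp Require Import ssreflect ssrfun ssrbool eqtype ssrnat seq path.

Set Implicit Arguments.
Unset Strict Implicit.
Unset Printing Implicit Defensive.

Open Scope R_scope.

(* Monomial basis of H_beta^fin:  J_{-n_1} ... J_{-n_k} Omega_beta is   *)
(* encoded by the partition (n_1,...,n_k), stored as a sequence of      *)
(* positive naturals sorted increasingly (canonical form).              *)

Definition is_part (l : seq nat) : bool := sorted leq l && all (fun n => 0 < n)%N l.

(* squared norm  || J_{-lambda} Omega ||^2 = prod_n n^{m_n} m_n!  *)
Definition znorm (l : seq nat) : R :=
  foldr (fun n acc => pow (INR n) (count_mem n l) * INR (fact (count_mem n l)) * acc)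
        1 (undup l).

Fixpoint compsF (fuel a : nat) : seq (seq nat) :=
  if a is 0 then [:: [::]] else
  match fuel with
  | 0 => [::]
  | f.+1 => flatten [seq [seq i :: c | c <- compsF f (a - i)] | i <- iota 1 a]
  end.
Definition comps (a : nat) : seq (seq nat) := compsF a a.

Definition parts (a : nat) : seq (seq nat) := filter (sorted leq) (comps a).
Definition parts_le (N : nat) : seq (seq nat) := flatten [seq parts a | a <- iota 0 N.+1].

(* Finite vectors as formal finite linear combinations of basis vectors *)

Definition C0 : C := RtoC 0.
Definition Csum (l : seq C) : C := foldr Cplus C0 l.

Definition scaleV {B : Type} (r : R) (v : seq (C * B)) : seq (C * B) :=
  map (fun tm => (Cmult (RtoC r) tm.1, tm.2)) v.

(* vectors of  \hat H^fin = (+)_j H^fin_{j alpha0}:  basis (j, lambda) *)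
Definition fvec := seq (C * (Z * seq nat)).

Definition crea (n : nat) (v : fvec) : fvec :=
  map (fun tm => (tm.1, (tm.2.1, sort leq (n :: tm.2.2)))) v.

(* annihilation operator J_n, n > 0:  J_n J_{-lambda} Omega = n m_n J_{-(lambda - n)} Omega *)
Definition anni (n : nat) (v : fvec) : fvec :=
  map (fun tm => (Cmult (RtoC (INR (n * count_mem n tm.2.2))) tm.1,
                  (tm.2.1, rem n tm.2.2))) v.

Definition shiftc (p : Z) (v : fvec) : fvec :=
  map (fun tm => (tm.1, ((tm.2.1 + p)%Z, tm.2.2))) v.

(* coefficient of exp(X) at X-degree given by the composition cmp:
   exp(sum_n a X_n z^{+-n}/n) = sum_k 1/k! sum_{n_1..n_k} prod (a/n_i) X_{n_1}..X_{n_k} z^{+-sum n_i} *)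
Definition expcoef (a : R) (cmp : seq nat) : R :=
  / INR (fact (size cmp)) * foldr (fun n acc => a / INR n * acc) 1 cmp.

(* coefficient of z^a in E^-(al, z) = exp( sum_{n>0} al J_{-n} z^n / n ) *)
Definition Emin (al : R) (a : nat) (v : fvec) : fvec :=
  flatten [seq scaleV (expcoef al cmp) (foldr crea v cmp) | cmp <- comps a].

(* coefficient of z^{-b} in E^+(al, z) = exp( - sum_{n>0} al J_n z^{-n} / n ) *)
Definition Eplus (al : R) (b : nat) (v : fvec) : fvec :=
  flatten [seq scaleV (expcoef (- al) cmp) (foldr anni v cmp) | cmp <- comps b].

(* Y_{alpha,s} for alpha = p * alpha0, with Y_alpha(z) = sum_s Y_{alpha,s} z^{-s-d},
   d = alpha^2/2, Y_alpha(z) = c_alpha E^-(alpha,z) E^+(alpha,z) z^{alpha J_0}.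
   On a basis vector of H_beta (beta = j alpha0) of degree |lambda|, the z-exponent
   of E^-_a E^+_b z^{alpha beta} is alpha beta + a - b; we collect the terms with
   alpha beta + a - b = - s - d  (b beyond |lambda| contribute zero). *)
Definition Ycoef (a0 : R) (p : Z) (s : R) (v : fvec) : fvec :=
  flatten (map (fun tm =>
    let al := IZR p * a0 in
    let x := - s - al ^ 2 / 2 - al * (IZR tm.2.1 * a0) in
    if Req_EM_T x (IZR (Int_part x)) then
      let k := Int_part x in
      shiftc p (flatten
        [seq Emin al (Z.to_nat (k + Z.of_nat b)) (Eplus al b [:: tm])
        | b <- iota 0 (sumn tm.2.2).+1 & Z.leb 0 (k + Z.of_nat b)])
    else [::]) v).

Definition coef1 (v : fvec) (j : Z) (l : seq nat) : C :=
  Csum [seq (if Z.eqb tm.2.1 j && (tm.2.2 == l) then tm.1 else C0) | tm <- v].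

(* The domain D = (+)_j H^fin_j (x) H^fin_j, basis (j, lambda, mu)      *)

Definition tvec := seq (C * (Z * seq nat * seq nat)).

Definition inD (Psi : tvec) : bool :=
  all (fun tm => is_part tm.2.1.2 && is_part tm.2.2) Psi.

Definition fsumR (f : R -> C) : C :=
  match excluded_middle_informative
          (exists l : list R, forall t, f t <> C0 -> List.In t l) with
  | left H =>
      let l := proj1_sig (constructive_indefinite_description _ H) in
      Csum (map f (List.nodup Req_EM_T l))
  | right _ => C0
  end.

(* Vectors of the completed space (+)_j H_j (x) H_j given by their
   coefficients on the (orthogonal) basis J_{-l}Omega_j (x) J_{-m}Omega_j. *)
Definition hvec := Z -> seq nat -> seq nat -> C.

(* Phi_{alpha,s} Psi = sum_{t in R} (Y_{alpha,t} (x) Y_{alpha,t-s}) Psi,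
   alpha = p * alpha0, given componentwise. *)
Definition Phi (a0 : R) (p s : Z) (Psi : tvec) : hvec :=
  fun j l m =>
    fsumR (fun t =>
      Csum [seq Cmult tm.1
                 (Cmult (coef1 (Ycoef a0 p t [:: (RtoC 1, (tm.2.1.1, tm.2.1.2))]) j l)
                        (coef1 (Ycoef a0 p (t - IZR s) [:: (RtoC 1, (tm.2.1.1, tm.2.2))]) j m))
           | tm <- Psi]).

Definition ip_fin_inf (Psi : tvec) (w : hvec) : C :=
  Csum [seq Cmult (Cmult (Cconj tm.1) (w tm.2.1.1 tm.2.1.2 tm.2.2))
                  (RtoC (znorm tm.2.1.2 * znorm tm.2.2)) | tm <- Psi].

Definition ip_inf_fin (w : hvec) (Psi : tvec) : C :=
  Csum [seq Cmult (Cmult (Cconj (w tm.2.1.1 tm.2.1.2 tm.2.2)) tm.1)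
                  (RtoC (znorm tm.2.1.2 * znorm tm.2.2)) | tm <- Psi].

(* finite boxes exhausting the basis: |j| <= N, |lambda|, |mu| <= N *)
Definition charges (N : nat) : seq Z :=
  [seq (Z.of_nat i - Z.of_nat N)%Z | i <- iota 0 (N + N).+1].

Definition ip_box (w1 w2 : hvec) (N : nat) : C :=
  Csum [seq Csum [seq Csum [seq Cmult (Cmult (Cconj (w1 j l m)) (w2 j l m))
                                      (RtoC (znorm l * znorm m))
                           | m <- parts_le N]
                 | l <- parts_le N]
       | j <- charges N].

Definition ip_inf_is (w1 w2 : hvec) (L : C) : Prop :=
  filterlim (ip_box w1 w2) eventually (locally L).

(* Main.v *)
(** On the level of coefficients
    [E^+(alpha, w) E^-(beta, z) = (1 - z/w)^(alpha beta) E^-(beta, z) E^+(alpha, w)],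
    so the degree [d] part of a matrix element of [Y_alpha Y_beta] is a finite
    combination, with coefficients coming from the normally ordered product, of
    shifted binomial coefficients [c_k] of [(1 - x)^(alpha beta)].  Tensoring with
    the mirror image turns the inner products of (ii) into finite combinations of
    the autocorrelations [sum_k c_k c_(k+h)], which converge absolutely because
    [|alpha beta| < 1/2] makes [c] square summable.  Exchanging [alpha] and [beta]
    leaves the normally ordered product unchanged and replaces [h] by [-h], under
    which an autocorrelation is invariant.  All adjoint relations come from
    [J_n^* = J_{-n}] for the pairing restricted to a fixed degree. *)

Require Import Defs.
From Stdlib Require ClassicalEpsilon.
From Stdlib Require Import Reals ZArith Lra Lia.
From Coquelicot Require Import Coquelicot.
From HB Require Import structures.
From mathcomp Require Import all_boot all_order all_algebra.
From mathcomp Require Import boolp functions Rstruct zify.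

Set Implicit Arguments.
Unset Strict Implicit.
Unset Printing Implicit Defensive.

Import GRing.Theory Num.Theory.

(* [%Z], [%R] and the two names below have other meanings after the imports. *)
Delimit Scope Z_scope with BZ.
Delimit Scope R_scope with SR.
Local Notation coef1 := Defs.coef1.
Local Notation Eplus := Defs.Eplus.

Local Open Scope ring_scope.

(** * Coefficients of exponentials of commuting operators *)

(** For a single tensor factor the two orders really differ: the powers [x^s] that accompany
    [(1 - x)^(alpha beta)] become [x^(L - s)], where [L] is the sum of the degrees of the two outer
    vectors. In the tensor product only the difference of the shifts of the two factors survives,
    and reversing both shifts merely changes the sign of the lag. This is an identity between
    limits. [Phi] leads in general to infinitely many degrees, and a box cuts off the two
    autocorrelations at different places, so that the two orders need not agree in any given box.
    Hence matrix elements are first brought into a form whose coefficients do not depend on the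
    intermediate degree [d]. The bound is the natural one: the coefficients of [(1 - x)^(-g)] are of
    order at most [k^(g - 1)], with summable squares when [g < 1/2]. All matrix elements in the
    monomial basis are real; complex numbers enter only through the coefficients of the finite
    vectors. *)

Lemma compsFS f a : compsF f.+1 a.+1 =
  flatten [seq [seq i :: c | c <- compsF f (a.+1 - i)] | i <- iota 1 a.+1].
Proof. by []. Qed.

Lemma compsF_fuel f a : (a <= f)%N -> compsF f a = comps a.
Proof.
elim/ltn_ind: a f => -[|a] IH [|f] // le_af.
rewrite /comps !compsFS; congr flatten; apply/eq_in_map => i.
rewrite mem_iota => /andP[i_gt0 _].
rewrite (IH (a.+1 - i)%N); [|lia|lia].
by rewrite (IH (a.+1 - i)%N) //; lia.
Qed.

Lemma comps_rec a : (0 < a)%N ->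
  comps a = flatten [seq [seq i :: c | c <- comps (a - i)] | i <- iota 1 a].
Proof.
case: a => // a _; rewrite {1}/comps compsFS; congr flatten; apply/eq_in_map => i.
rewrite mem_iota => /andP[i_gt0 _]; rewrite compsF_fuel //; lia.
Qed.

Lemma comps0 : comps 0 = [:: [::]]. Proof. by []. Qed.

Lemma sum_triangle (V : nmodType) (G : nat -> nat -> V) N :
  \sum_(n < N) \sum_(m < N - n.+1) G n m
  = \sum_(m < N) \sum_(n < N - m.+1) G n m.
Proof.
have E (H : nat -> nat -> V) : \sum_(n < N) \sum_(m < N - n.+1) H n m
   = \sum_(n < N) \sum_(m < N | (n + m.+1 < N)%N) H n m.
  apply: eq_bigr => n _.
  rewrite (big_ord_widen_cond N xpredT); last by lia.
  by apply: eq_bigl => m; have := ltn_ord n; have := ltn_ord m; lia.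
rewrite E (E (fun m n => G n m)) (exchange_big_dep xpredT) //=.
by apply: eq_bigr => m _; apply: eq_bigl => n; lia.
Qed.

Lemma sum_diagonals (V : nmodType) (G : nat -> nat -> V) N :
  \sum_(n < N) \sum_(m < N - n) G n m
  = \sum_(r < N) \sum_(m < r.+1) G (r - m)%N m.
Proof.
elim: N => [|N IH]; first by rewrite !big_ord0.
rewrite big_ord_recr /= subSn // subnn big_ord1.
rewrite (eq_bigr (fun n : 'I_N => \sum_(m < N - n) G n m + G n (N - n)%N)); last first.
  by move=> n _; rewrite subSn ?big_ord_recr //; apply: ltnW.
rewrite big_split /= IH -addrA [RHS]big_ord_recr /=; congr (_ + _).
rewrite (reindex_inj rev_ord_inj) /= [RHS]big_ord_recl /= subn0 addrC; congr (_ + _).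
apply: eq_bigr => i _; rewrite /bump /=; congr G; have := ltn_ord i; lia.
Qed.

Lemma sum_triangle_le (V : nmodType) (G : nat -> nat -> V) N :
  \sum_(n < N) \sum_(m < N - n) G n m = \sum_(m < N) \sum_(n < N - m) G n m.
Proof.
rewrite sum_diagonals (sum_diagonals (fun m n => G n m)); apply: eq_bigr => r _.
rewrite (reindex_inj rev_ord_inj) /=; apply: eq_bigr => m _.
by congr G; have := ltn_ord m; lia.
Qed.

Section ExpCoefficients.
Variables (F : numFieldType) (V : lmodType F).
Implicit Types (X : nat -> {linear V -> V}) (x : F) (v : V).

Definition expw x (c : seq nat) : F := foldr (fun n acc => x / n%:R * acc) 1 c.

Definition expC x (c : seq nat) : F := (size c)`!%:R^-1 * expw x c.

Definition word X v (c : seq nat) : V := foldr (fun n u => X n u) v c.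

(* The coefficient of [z^N] in [exp (x * sum_n X_n z^n / n)]. *)
Definition expX X x N v : V := \sum_(c <- comps N) expC x c *: word X v c.

(** The [k]-th power of the exponent, without [1/k!]. Splitting by length is what permits recursion
    on the first factor, since [1/k!] is not multiplicative along a composition. *)
Definition expXk X x N k v : V :=
  \sum_(c <- comps N | size c == k) expw x c *: word X v c.

Lemma expXk0 X x N v : expXk X x N 0 v = if N == 0%N then v else 0.
Proof.
rewrite /expXk; case: N => [|N] /=.
  by rewrite comps0 big_cons big_nil /= scale1r addr0.
rewrite big1_seq // => c /andP[/eqP/size0nil ->].
rewrite comps_rec // => /flattenP[s /mapP[i _ ->] /mapP[d _]] //.
Qed.

Lemma expXkS X x N k v :
  expXk X x N k.+1 v = \sum_(n < N) (x / n.+1%:R) *: X n.+1 (expXk X x (N - n.+1) k v).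
Proof.
case: N => [|N].
  by rewrite big_ord0 /expXk comps0 big_cons big_nil.
rewrite /expXk comps_rec // big_flatten big_map.
rewrite (iotaDl 1 0) big_map.
rewrite -[iota 0 N.+1]/(index_iota 0 N.+1) big_mkord.
apply: eq_bigr => n _; rewrite big_map linear_sum scaler_sumr.
by apply: eq_bigr => c _; rewrite /= linearZ /= scalerA.
Qed.

Lemma expX_sum_k X x N K v : (N < K)%N ->
  expX X x N v = \sum_(k < K) k`!%:R^-1 *: expXk X x N k v.
Proof.
have E c : c \in comps N -> (size c <= N)%N.
  elim/ltn_ind: N c => -[|N] IH c; first by rewrite comps0 inE => /eqP->.
  rewrite comps_rec // => /flattenP[s /mapP[i]].
  rewrite mem_iota => Hi -> /mapP[d Hd ->] /=.
  have lt_iN : (N.+1 - i < N.+1)%N by lia.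
  exact: leq_ltn_trans (IH _ lt_iN d Hd) lt_iN.
move=> lt_NK.
rewrite /expX big_seq_cond.
rewrite (eq_bigr (fun c => \sum_(k < K | size c == k) (k`!%:R^-1 * expw x c) *: word X v c)).
  rewrite (exchange_big_dep xpredT) //=; apply: eq_bigr => k _.
  rewrite /expXk scaler_sumr [RHS]big_seq_cond; apply: eq_big => [c|c _]; first by rewrite andbT.
  by rewrite scalerA.
move=> c /andP[/E sc _].
by rewrite (big_pred1 (Ordinal (leq_ltn_trans sc lt_NK))) // => i; rewrite eq_sym.
Qed.

(** With [L] the exponent, this is [z (L^(k+1))' = (k+1) (z L') L^k]; commutativity brings the
    differentiated factor to the front. *)
Lemma expXk_rec X x N k v : (forall m n u, X m (X n u) = X n (X m u)) ->
  N%:R *: expXk X x N k.+1 v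
  = (k.+1%:R * x) *: \sum_(n < N) X n.+1 (expXk X x (N - n.+1) k v).
Proof.
move=> comm; elim: k N => [|k IH] N.
  rewrite expXkS !scaler_sumr; apply: eq_bigr => n _.
  rewrite scalerA expXk0; have := ltn_ord n; case: eqP => [E lt_nN|]; last by rewrite !linear0 ?scaler0.
  have -> : N%:R = n.+1%:R :> F by congr (_%:R); lia.
  congr (_ *: _); rewrite mul1r mulrC mulfVK // pnatr_eq0 //.
rewrite expXkS scaler_sumr.
have -> : (k.+2%:R * x) *: (\sum_(n < N) X n.+1 (expXk X x (N - n.+1) k.+1 v)) =
   \sum_(n < N) x *: X n.+1 (expXk X x (N - n.+1) k.+1 v) +
   (k.+1%:R * x) *: (\sum_(n < N) X n.+1 (expXk X x (N - n.+1) k.+1 v)).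
  by rewrite -scaler_sumr -scalerDl; congr (_ *: _); rewrite -[k.+2]add1n natrD mulrDl mul1r.
(* Exchanging the two outermost modes moves the weight [x / n] from the inner one to the outer
   one. *)
have -> : \sum_(n < N) X n.+1 (expXk X x (N - n.+1) k.+1 v) =
   \sum_(n < N) \sum_(m < N - n.+1) (x / n.+1%:R) *: X n.+1 (X m.+1 (expXk X x (N - n.+1 - m.+1) k v)).
  rewrite (sum_triangle (fun n m => (x / n.+1%:R) *:
    X n.+1 (X m.+1 (expXk X x (N - n.+1 - m.+1) k v)))); apply: eq_bigr => n _.
  rewrite expXkS linear_sum; apply: eq_bigr => m _.
  by rewrite linearZ /= comm; congr (_ *: X _ (X _ (expXk _ _ _ _ _))); lia.
rewrite scaler_sumr -big_split; apply: eq_bigr => n _ /=.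
rewrite -scaler_sumr -linear_sum scalerA.
(* Leibniz rule: the degree [N] splits into that of the first factor and that of the rest. *)
have -> : N%:R = n.+1%:R + (N - n.+1)%:R :> F by rewrite -natrD subnKC.
rewrite mulrDl scalerDl; congr (_ + _).
  by congr (_ *: _); rewrite mulrC mulfVK // pnatr_eq0.
rewrite [in LHS]mulrC -[in LHS]scalerA -[in LHS](linearZ_LR (X n.+1)) IH linearZ /=.
by rewrite !scalerA; congr (_ *: _); rewrite mulrC.
Qed.

Lemma expX0 X x v : expX X x 0 v = v.
Proof.
rewrite /expX comps0 big_cons big_nil /= /expC /expw /= addr0.
by rewrite fact0 invr1 mul1r scale1r.
Qed.

(* The logarithmic derivative of the exponential generating series. *)
Lemma expX_rec X x N v : (forall m n u, X m (X n u) = X n (X m u)) ->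
  N%:R *: expX X x N v = x *: \sum_(n < N) X n.+1 (expX X x (N - n.+1) v).
Proof.
move=> comm; rewrite (@expX_sum_k _ _ _ N.+1) // big_ord_recl scalerDr expXk0.
have -> : N%:R *: ((ord0 : 'I_N.+1)`!%:R^-1 *: (if N == 0%N then v else 0)) = 0.
  by case: eqP => [->|_]; rewrite ?scale0r ?scaler0.
rewrite add0r scaler_sumr.
under eq_bigr => k _.
  rewrite scalerA mulrC -scalerA (expXk_rec _ _ _ _ comm) scalerA.
  have -> : (lift ord0 k)`!%:R^-1 * (k.+1%:R * x) = x * (k`!%:R^-1) :> F.
    rewrite /= /bump /= add1n factS natrM invfM.
    have h : k.+1%:R != 0 :> F by rewrite pnatr_eq0.
    by rewrite mulrACA mulVf // mul1r mulrC.
  rewrite -scalerA scaler_sumr.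
  over.
rewrite -scaler_sumr exchange_big; congr (_ *: _); apply: eq_bigr => n _ /=.
rewrite (@expX_sum_k _ _ _ N); last by have := ltn_ord n; lia.
by rewrite linear_sum; apply: eq_bigr => k _; rewrite linearZ.
Qed.

Lemma word_is_linear X c : linear (word X ^~ c).
Proof. by move=> a u v; elim: c => //= n c ->; rewrite linearP. Qed.

Lemma expX_is_linear X x N : linear (expX X x N).
Proof.
move=> a u v; rewrite /expX scaler_sumr -big_split; apply: eq_bigr => c _ /=.
by rewrite word_is_linear scalerDr !scalerA mulrC.
Qed.

HB.instance Definition _ X x N :=
  GRing.isLinear.Build F V V *:%R (expX X x N) (expX_is_linear X x N).

Lemma expX_comm X x N (L : {linear V -> V}) v :
  (forall n u, L (X n u) = X n (L u)) -> L (expX X x N v) = expX X x N (L v).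
Proof.
move=> comm; rewrite /expX linear_sum; apply: eq_bigr => c _.
by rewrite linearZ /=; congr (_ *: _); elim: c => //= n c <-.
Qed.

Lemma expX_expX X x y N M v : (forall m n u, X m (X n u) = X n (X m u)) ->
  expX X x N (expX X y M v) = expX X y M (expX X x N v).
Proof.
by move=> comm; apply: expX_comm => n u /=; rewrite -expX_comm.
Qed.

(** * Exchange of exponentials under the canonical commutation relations *)

Section CanonicalCommutation.
Variables (a c : nat -> {linear V -> V}).
Hypothesis aa : forall m n u, a m (a n u) = a n (a m u).
Hypothesis cc : forall m n u, c m (c n u) = c n (c m u).
Hypothesis ac : forall m n u,
  a n (c m u) = c m (a n u) + (if m == n then n%:R *: u else 0).

(** The guard matters: [N - k] is 0 for [k > N], where the exponential would return [v] instead of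
    0. *)
Definition expX_shift y N k v : V := if (k <= N)%N then expX c y (N - k) v else 0.

Lemma expX_shift_is_linear y N k : linear (expX_shift y N k).
Proof.
by move=> z u v; rewrite /expX_shift; case: leqP => _; rewrite ?linearP ?scaler0 ?addr0.
Qed.

HB.instance Definition _ y N k :=
  GRing.isLinear.Build F V V *:%R (expX_shift y N k) (expX_shift_is_linear y N k).

(** The commutator of [a n] with the exponent is the scalar [y z^n], so its commutator with the
    exponential is [y z^n] times the exponential. *)
Lemma ann_expX n y N v : (0 < n)%N ->
  a n (expX c y N v) = expX c y N (a n v) + y *: expX_shift y N n v.
Proof.
move=> n_gt0; elim/ltn_ind: N => N IH.
case: (posnP N) => [->|N_gt0].
  by rewrite !expX0 /expX_shift leqNgt n_gt0 scaler0 addr0.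
have Nn0 : N%:R != 0 :> F by rewrite pnatr_eq0 -lt0n.
apply: (scalerI Nn0); rewrite -linearZ /= expX_rec // linearZ linear_sum /=.
rewrite scalerDr expX_rec //.
under eq_bigr => m _.
  rewrite ac IH; last by have := ltn_ord m; lia.
  rewrite linearD linearZ /=.
  over.
rewrite !big_split /= !scalerDr -addrA; congr (_ + _).
rewrite scalerA [_ * y]mulrC -scalerA -scalerDr; congr (y *: _).
rewrite -scaler_sumr /expX_shift.
case: (leqP n N) => [le_nN|lt_Nn]; last first.
  rewrite !big1 ?scaler0 ?addr0 // => m _; have lt_mN := ltn_ord m.
    by rewrite ifF //; lia.
  by rewrite ifF ?linear0 //; lia.
have pN : (n.-1 < N)%N by lia.
(* The central term survives only at the mode [n] and has weight [n]; the remaining sum is the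
   logarithmic derivative in degree [N - n] and has weight [N - n]. *)
rewrite [X in _ + X](bigD1 (Ordinal pN)) //= prednK // eqxx.
rewrite [X in _ + (_ + X)]big1 ?addr0; last first.
  by move=> m; rewrite -val_eqE /= => ?; rewrite ifF //; lia.
have -> : \sum_(i < N) c i.+1 (if (n <= N - i.+1)%N then expX c y (N - i.+1 - n) v else 0) =
   \sum_(i < N - n) c i.+1 (expX c y (N - n - i.+1) v).
  rewrite (big_ord_widen N (fun i => c i.+1 (expX c y (N - n - i.+1) v))); last exact: leq_subr.
  rewrite [RHS]big_mkcond; apply: eq_bigr => i _; have := ltn_ord i => lt_iN.
  have -> : (i < N - n)%N = (n <= N - i.+1)%N by lia.
  by case: leqP => _; rewrite ?linear0 // subnAC.
by rewrite -expX_rec // -scalerDl -natrD subnK.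
Qed.

(* The coefficients of [(1 - z)^(-g)]. *)
Fixpoint binc (g : F) (k : nat) : F :=
  if k is k'.+1 then binc g k' * (k'%:R + g) / k%:R else 1.

(** The differential equation [z F' = g z (1 - z)^(-1) F] of [F = (1 - z)^(-g)]. *)
Lemma binc_sum g r : r%:R * binc g r = g * \sum_(k < r) binc g k.
Proof.
elim: r => [|r IH]; first by rewrite big_ord0 mul0r mulr0.
by rewrite big_ord_recr /= [in RHS]mulrDr -IH mulrC mulfVK ?pnatr_eq0 // mulrC mulrDl.
Qed.

(* [E^+(w) E^-(z) = (1 - z/w)^(-xy) E^-(z) E^+(w)], coefficientwise. *)
Lemma expX_exchange x y b N v :
  expX a x b (expX c y N v)
  = \sum_(k < b.+1) binc (x * y) k *: expX_shift y N k (expX a x (b - k) v).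
Proof.
elim/ltn_ind: b => b IH.
case: (posnP b) => [->|b_gt0].
  by rewrite big_ord1 expX0 scale1r /expX_shift /= subn0 expX0.
have bn0 : b%:R != 0 :> F by rewrite pnatr_eq0 -lt0n.
apply: (scalerI bn0); rewrite expX_rec //.
have a_shift n k u : (0 < n)%N ->
    a n (expX_shift y N k u) = expX_shift y N k (a n u) + y *: expX_shift y N (k + n) u.
  move=> n_gt0; rewrite /expX_shift; case: leqP => [le_kN|lt_Nk].
    rewrite ann_expX // /expX_shift subnDA.
    have -> : (k + n <= N)%N = (n <= N - k)%N by lia.
    by [].
  by case: leqP => [|_]; rewrite ?linear0 ?scaler0 ?addr0 //; lia.
under eq_bigr => n _.
  rewrite IH; last by have := ltn_ord n; lia.
  rewrite linear_sum /=.
  under eq_bigr => k _ do rewrite linearZ /= a_shift // scalerDr.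
  rewrite big_split /=.
  over.
rewrite big_split /= scalerDr.
(* [T1] collects the terms where the annihilator passes through, [T2] the commutators. They
   contribute the weights [b - k] and [k] to the [k]-th term, which together make [b]. *)
pose T1 n k := binc (x * y) k *: expX_shift y N k (a n.+1 (expX a x (b - n.+1 - k) v)).
pose T2 n k := binc (x * y) k *: (y *: expX_shift y N (k + n.+1) (expX a x (b - n.+1 - k) v)).
have E (T : nat -> nat -> V) :
    \sum_(n < b) \sum_(k < (b - n.+1).+1) T n k = \sum_(n < b) \sum_(k < b - n) T n k.
  by apply: eq_bigr => n _; rewrite subnSK.
rewrite (E T1) (E T2) sum_triangle_le sum_diagonals.
pose S k := binc (x * y) k *: expX_shift y N k (expX a x (b - k) v).
have -> : x *: (\sum_(k < b) \sum_(n < b - k) T1 n k) = \sum_(k < b.+1) (b - k)%:R *: S k.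
  rewrite big_ord_recr /= subnn scale0r addr0 scaler_sumr; apply: eq_bigr => k _.
  transitivity (binc (x * y) k *: expX_shift y N k ((b - k)%:R *: expX a x (b - k) v)).
    rewrite expX_rec // /T1 -scaler_sumr -linear_sum (linearZ_LR (expX_shift y N k)) /= !scalerA mulrC.
    congr (_ *: _); congr (expX_shift _ _ _ _); apply: eq_bigr => n _.
    by rewrite subnAC.
  by rewrite linearZ /= !scalerA mulrC.
have -> : x *: (\sum_(r < b) \sum_(k < r.+1) T2 (r - k)%N k) = \sum_(k < b.+1) k%:R *: S k.
  rewrite big_ord_recl scale0r add0r scaler_sumr; apply: eq_bigr => r _.
  rewrite /S /= /bump add1n scalerA binc_sum -scalerA scaler_suml !scaler_sumr.
  apply: eq_bigr => k _; rewrite /T2 !scalerA.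
  have -> : (k + (r - k).+1)%N = r.+1 by have := ltn_ord k; lia.
  have -> : (b - (r - k).+1 - k)%N = (b - r.+1)%N by have := ltn_ord k; lia.
  by rewrite mulrAC.
rewrite -big_split scaler_sumr; apply: eq_bigr => k _ /=.
by rewrite -scalerDl -natrD subnK // -ltnS.
Qed.
End CanonicalCommutation.
End ExpCoefficients.

(** * The bosonic Fock space *)

Lemma mem_comps a s : (s \in comps a) = all (fun n => (0 < n)%N) s && (sumn s == a).
Proof.
elim/ltn_ind: a s => a IH s.
case: (posnP a) => [->|a_gt0].
  by rewrite comps0 inE; case: s => //= -[|n] s //=; rewrite andbF.
rewrite comps_rec //; apply/flattenP/idP.
  move=> [u /mapP[i]]; rewrite mem_iota => Hi -> /mapP[t].
  rewrite IH; last by lia.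
  by move=> /andP[pos_t sum_t] -> /=; rewrite pos_t /=; lia.
case: s => [|i s] /=; first by move=> H; lia.
move=> /andP[/andP[i_gt0 pos_s] /eqP sum_s].
exists [seq i :: c | c <- comps (a - i)].
  by apply/mapP; exists i => //; rewrite mem_iota; lia.
by apply/mapP; exists s => //; rewrite IH; [rewrite pos_s /=; lia|lia].
Qed.

Lemma comps_uniq a : uniq (comps a).
Proof.
elim/ltn_ind: a => a IH; case: (posnP a) => [->//|a_gt0].
rewrite comps_rec //; apply: (@allpairs_uniq_dep _ _ _ (fun i c => i :: c)).
- exact: iota_uniq.
- by move=> i; rewrite mem_iota => Hi; apply: IH; lia.
by move=> /= [i c] [j d] _ _ /= [-> ->].
Qed.

Lemma mem_parts a s : (s \in parts a) = is_part s && (sumn s == a).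
Proof. by rewrite mem_filter mem_comps andbA. Qed.

Lemma parts_uniq a : uniq (parts a).
Proof. exact/filter_uniq/comps_uniq. Qed.

Lemma is_part_sort s : is_part (sort leq s) = all (fun n => (0 < n)%N) s.
Proof. by rewrite /is_part all_sort sort_sorted //; apply: leq_total. Qed.

(* Parts equal to [0] are harmless: [ann 0 = 0], so that the commutation relations
   below hold for them too. *)
Definition mset := {s : seq nat | sorted leq s}.

Definition toM (s : seq nat) : mset := exist _ (sort leq s) (sort_sorted leq_total s).

Lemma toM_perm s t : perm_eq s t -> toM s = toM t.
Proof.
by move=> st; apply: val_inj; apply/perm_sortP => //;
  [exact: leq_total | exact: leq_trans | exact: anti_leq].
Qed.

Lemma val_toM s : perm_eq (val (toM s)) s.
Proof. by rewrite /= perm_sort. Qed.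

Lemma toM_val (l : mset) : toM (val l) = l.
Proof. by apply: val_inj; rewrite /= sorted_sort //; [exact: leq_trans | exact: valP]. Qed.

Lemma toM_part s : is_part s -> val (toM s) = s.
Proof. by move=> /andP[? _]; rewrite /= sorted_sort //; exact: leq_trans. Qed.

Lemma mem_rem_neq (m n : nat) s : m != n -> (m \in rem n s) = (m \in s).
Proof.
move=> mn; rewrite -!has_pred1 !has_count count_mem_rem.
by rewrite eq_sym (negbTE mn) subn0.
Qed.

Section FockSpace.
Variable F : numFieldType.

(** Coefficient functions in the monomial basis, with no condition on the support: each operator
    below computes a coefficient from finitely many others, and equality is extensional. *)
Definition fock := mset -> F^o.

Definition cre n (f : fock) : fock :=
  fun l => if n \in val l then f (toM (rem n (val l))) else 0.

(** The coefficient at [l] comes from [l] enlarged by a part [n], whose multiplicity there is one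
    higher; hence the successor. *)
Definition ann n (f : fock) : fock :=
  fun l => (n * (count_mem n (val l)).+1)%:R * f (toM (n :: val l)).

Lemma cre_is_linear n : linear (cre n).
Proof.
move=> a f g; apply: funext => l; rewrite /cre !fctE.
by case: ifP => // _; rewrite scaler0 addr0.
Qed.

Lemma ann_is_linear n : linear (ann n).
Proof.
move=> a f g; apply: funext => l; rewrite /ann !fctE mulrDr; congr (_ + _).
by rewrite /GRing.scale /= mulrCA.
Qed.

HB.instance Definition _ n :=
  GRing.isLinear.Build F fock fock *:%R (cre n) (cre_is_linear n).
HB.instance Definition _ n :=
  GRing.isLinear.Build F fock fock *:%R (ann n) (ann_is_linear n).

Lemma cre_cre m n f : cre m (cre n f) = cre n (cre m f).
Proof.
have [->//|mn] := eqVneq m n.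
apply: funext => l; rewrite /cre !(perm_mem (val_toM _)).
rewrite mem_rem_neq 1?eq_sym // mem_rem_neq //.
case: (m \in val l); case: (n \in val l) => //; congr f; apply: toM_perm.
apply/allP => x _ /=; apply/eqP; rewrite !count_mem_rem.
by rewrite !(permP (val_toM _)) !count_mem_rem subnAC.
Qed.

Lemma ann_ann m n f : ann m (ann n f) = ann n (ann m f).
Proof.
have [->//|mn] := eqVneq m n.
apply: funext => l; rewrite /ann !(permP (val_toM _)) /=.
rewrite (negbTE mn) eq_sym (negbTE mn) !add0n mulrCA; congr (_ * (_ * f _)).
apply: toM_perm; apply/permP => P /=.
by rewrite !(permP (val_toM _)) /= addnCA.
Qed.

Lemma ann_cre m n f :
  ann n (cre m f) = cre m (ann n f) + (if m == n then n%:R *: f else 0).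
Proof.
apply: funext => l; rewrite !fctE /ann /cre !(perm_mem (val_toM _)) inE.
have [->|mn] := eqVneq m n.
  rewrite /=.
  have -> : toM (rem n (val (toM (n :: val l)))) = l.
    rewrite -[RHS]toM_val; apply: toM_perm; apply/allP => x _ /=; apply/eqP.
    by rewrite count_mem_rem (permP (val_toM _)) /= addKn.
  case: ifP => nl.
    rewrite (permP (val_toM _)) count_mem_rem eqxx.
    have -> : toM (n :: val (toM (rem n (val l)))) = l.
      rewrite -[RHS]toM_val; apply: toM_perm.
      by rewrite perm_sym (permPl (perm_to_rem nl)) perm_cons perm_sym val_toM.
    have c_gt0 : (0 < count_mem n (val l))%N by rewrite -has_count has_pred1.
    rewrite subn1 prednK // -mulrDl; congr (_ * _).
    by rewrite -natrD mulnS addnC.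
  rewrite add0r (count_memPn _) ?nl // muln1 //.
rewrite orFb addr0.
case: ifP => ml; last by rewrite mulr0.
rewrite (permP (val_toM _)) count_mem_rem (negbTE mn) subn0.
congr (_ * f _); apply: toM_perm; apply/allP => x _ /=; apply/eqP.
rewrite count_mem_rem !(permP (val_toM _)) /= !count_mem_rem.
have : (0 < count_mem m (sval l))%N by rewrite -has_count has_pred1.
have [<-|_ _] := eqVneq m x; last by rewrite !subn0.
by move=> c_gt0; rewrite addnBA.
Qed.

(** * The pairing in a fixed degree *)

Definition sqnorm (s : seq nat) : F :=
  \prod_(n <- undup s) (n%:R ^+ count_mem n s * (count_mem n s)`!%:R).

Lemma sqnorm_perm s t : perm_eq s t -> sqnorm s = sqnorm t.
Proof.
move=> st; rewrite /sqnorm (perm_big _ (perm_undup (perm_mem st))) /=.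
by apply: eq_bigr => n _; rewrite (permP st).
Qed.

Lemma sqnorm_cons n s : sqnorm (n :: s) = (n * (count_mem n s).+1)%:R * sqnorm s.
Proof.
rewrite /sqnorm /=; case: ifP => ns.
  have nus : n \in undup s by rewrite mem_undup.
  rewrite !(bigD1_seq n nus (undup_uniq s)) /= eqxx add1n mulrA; congr (_ * _).
    by rewrite exprS factS !natrM mulrACA.
  by apply: eq_bigr => m mn; rewrite eq_sym (negbTE mn).
rewrite big_cons eqxx (count_memPn _) ?ns // muln1 expr1 mulr1; congr (_ * _).
rewrite !big_seq; apply: eq_bigr => m; rewrite mem_undup => ms.
by rewrite (_ : n == m = false) //; apply: contraFF ns => /eqP->.
Qed.

(** Restriction to one degree makes the sum finite for arbitrary coefficient functions. The form is
    bilinear; conjugation concerns only the coefficients of finite vectors. *)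
Definition fdot d (f g : fock) : F :=
  \sum_(s <- parts d) f (toM s) * g (toM s) * sqnorm s.

Lemma fdotC d f g : fdot d f g = fdot d g f.
Proof. by apply: eq_bigr => s _; rewrite [f _ * _]mulrC. Qed.

Lemma fdotZl d a f g : fdot d (a *: f) g = a * fdot d f g.
Proof. by rewrite /fdot mulr_sumr; apply: eq_bigr => s _; rewrite !fctE /GRing.scale /= !mulrA. Qed.

Lemma fdotZr d a f g : fdot d f (a *: g) = a * fdot d f g.
Proof. by rewrite fdotC fdotZl fdotC. Qed.

Lemma fdot0l d g : fdot d 0 g = 0.
Proof. by rewrite -(scale0r 0) fdotZl mul0r. Qed.

Lemma fdot0r d g : fdot d g 0 = 0.
Proof. by rewrite fdotC fdot0l. Qed.

Lemma fdot_suml d I r (P : pred I) (f : I -> fock) g :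
  fdot d (\sum_(i <- r | P i) f i) g = \sum_(i <- r | P i) fdot d (f i) g.
Proof.
rewrite /fdot exchange_big /=; apply: eq_bigr => s _.
by rewrite fct_sumE !mulr_suml.
Qed.

Lemma fdot_sumr d I r (P : pred I) (f : I -> fock) g :
  fdot d g (\sum_(i <- r | P i) f i) = \sum_(i <- r | P i) fdot d g (f i).
Proof. by rewrite fdotC fdot_suml; apply: eq_bigr => i _; rewrite fdotC. Qed.

Lemma mem_parts_le n d s : s \in parts d -> n \in s -> (n <= d)%N.
Proof.
rewrite mem_parts => /andP[_ /eqP <-]; elim: s => //= m s IH; rewrite inE.
by case/orP => [/eqP->|/IH]; lia.
Qed.

Lemma fdot_cre_small d n f g : (d < n)%N -> fdot d (cre n f) g = 0.
Proof.
move=> lt_dn; rewrite /fdot big1_seq // => s /= sd.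
rewrite /cre (perm_mem (val_toM _)); case: ifP => [ns|]; last by rewrite !mul0r.
by have := mem_parts_le sd ns; lia.
Qed.

(** Adding a part [n] maps the partitions of [d] bijectively onto those of [d + n] that contain [n],
    and the ratio of squared norms is the scalar in [ann]. *)
Lemma fdot_cre d n f g : (0 < n)%N -> fdot (d + n) (cre n f) g = fdot d f (ann n g).
Proof.
move=> n_gt0.
have E : perm_eq [seq s <- parts (d + n) | n \in s] [seq sort leq (n :: t) | t <- parts d].
  apply: uniq_perm; first exact/filter_uniq/parts_uniq.
    rewrite map_inj_in_uniq ?parts_uniq // => s t.
    rewrite !mem_parts => /andP[/andP[ss _] _] /andP[/andP[st _] _] E.
    have : perm_eq (n :: s) (n :: t) by rewrite -(perm_sort leq) E perm_sort.
    rewrite perm_cons => /(sorted_eq leq_trans anti_leq ss st) //.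
  move=> s; rewrite mem_filter mem_parts; apply/idP/mapP.
    move=> /andP[ns /andP[/andP[ss ps] sum_s]]; exists (rem n s); last first.
      apply: (sorted_eq leq_trans anti_leq ss); first exact/sort_sorted/leq_total.
      by rewrite perm_sym perm_sort perm_sym perm_to_rem.
    rewrite mem_parts /is_part (subseq_sorted leq_trans (rem_subseq n s) ss) /=.
    apply/andP; split; first by apply/allP => x /mem_rem /(allP ps).
    by move: sum_s; rewrite (perm_sumn (perm_to_rem ns)) /= addnC eqn_add2r.
  move=> [t]; rewrite mem_parts => /andP[/andP[st pt] /eqP sum_t] ->.
  rewrite is_part_sort mem_sort inE eqxx /= n_gt0 pt /= (perm_sumn (permEl (perm_sort _ _))) /=.
  by rewrite sum_t addnC.
rewrite /fdot /cre.
under eq_bigr => s _ do rewrite (perm_mem (val_toM _)).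
rewrite (bigID (fun s => n \in s)) /= [X in _ + X]big1 ?addr0; last first.
  by move=> s /negbTE->; rewrite !mul0r.
rewrite -big_filter (perm_big _ E) big_map big_seq [RHS]big_seq; apply: eq_bigr => t.
rewrite mem_parts => /andP[/andP[st pt] _].
rewrite mem_sort inE eqxx orTb (sqnorm_perm (permEl (perm_sort _ _))) sqnorm_cons.
have -> : toM (sort leq (n :: t)) = toM (n :: t) by apply: toM_perm; rewrite perm_sort.
have -> : toM (rem n (sort leq (sort leq (n :: t)))) = toM t.
  apply: toM_perm; apply/allP => x _ /=; apply/eqP.
  by rewrite count_mem_rem !(permP (permEl (perm_sort leq _))) /= addKn.
have tE : val (toM t) = t by apply: toM_part; rewrite /is_part st.
by rewrite /ann tE [_%:R * g _]mulrC !mulrA.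
Qed.

Let aa := ann_ann.
Let cc := cre_cre.

(** Induction along the logarithmic derivative needs only the adjoint of a single mode. *)
Lemma fdot_expX d x N f g :
  fdot (d + N) (expX cre x N f) g = fdot d f (expX ann x N g).
Proof.
elim/ltn_ind: N d f g => N IH d f g.
case: (posnP N) => [->|N_gt0]; first by rewrite addn0 !expX0.
have Nn0 : N%:R != 0 :> F by rewrite pnatr_eq0 -lt0n.
apply: (mulfI Nn0); rewrite -fdotZl -fdotZr !expX_rec //.
rewrite fdotZl fdotZr fdot_suml fdot_sumr; congr (_ * _); apply: eq_bigr => n _.
have lt_nN := ltn_ord n.
have -> : (d + N)%N = (d + (N - n.+1) + n.+1)%N by lia.
rewrite fdot_cre // IH; last by lia.
by rewrite -expX_comm // => m u; apply: aa.
Qed.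

Lemma fdot_expX_small d x N f g : (d < N)%N -> fdot d (expX cre x N f) g = 0.
Proof.
elim/ltn_ind: N d f g => N IH d f g lt_dN.
have Nn0 : N%:R != 0 :> F by rewrite pnatr_eq0 -lt0n; lia.
apply: (mulfI Nn0); rewrite -fdotZl mulr0 expX_rec //.
rewrite fdotZl fdot_suml big1 ?mulr0 // => n _.
have [lt_dn|le_nd] := ltnP d n.+1; first by rewrite fdot_cre_small.
rewrite -(subnK le_nd) fdot_cre // IH //; have := ltn_ord n; lia.
Qed.

End FockSpace.

(** * Matrix elements of vertex operators *)

Section MatrixElements.
Variable F : numFieldType.
Implicit Types (x y : F) (s l lam : seq nat) (d : nat).

Local Notation M := (expX (@cre F)).
Local Notation P := (expX (@ann F)).

Definition basis s : fock F := fun t => (t == toM s)%:R.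

Lemma fdot_basis l f : is_part l -> fdot (sumn l) f (basis l) = f (toM l) * sqnorm F l.
Proof.
move=> pl; have ml : l \in parts (sumn l) by rewrite mem_parts pl eqxx.
rewrite /fdot (bigD1_seq l) ?parts_uniq //= /basis eqxx mulr1.
rewrite big1_seq ?addr0 // => t /andP[tl]; rewrite mem_parts => /andP[pt _].
case: eqP => [E|]; last by rewrite mulr0 mul0r.
by rewrite -(toM_part pt) -(toM_part pl) E eqxx in tl.
Qed.

(* The degree [d] component of [E^-(x) E^+(x) J_{-lam} Omega]. *)
Definition ymode x lam d : fock F :=
  \sum_(e < (minn (sumn lam) d).+1) M x (d - e) (P (- x) (sumn lam - e) (basis lam)).

Definition ymat x lam l : F := ymode x lam (sumn l) (toM l).

Lemma fdot_expX_sub d x N f g : (N <= d)%N -> fdot d (M x N f) g = fdot (d - N) f (P x N g).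
Proof. by move=> le_Nd; rewrite -{1}(subnK le_Nd) fdot_expX. Qed.

(** The identity holds term by term in the degree [e] between annihilation and creation: the adjoint
    of the creation exponential of [x] is the annihilation exponential belonging to [- x]. *)
Lemma ymat_adjoint x lam l : is_part lam -> is_part l ->
  ymat x lam l * sqnorm F l = ymat (- x) l lam * sqnorm F lam.
Proof.
move=> plam pl; rewrite /ymat -!fdot_basis // /ymode !fdot_suml opprK minnC.
apply: eq_bigr => e _; have := ltn_ord e; rewrite ltnS leq_min => /andP[le1 le2].
by rewrite !fdot_expX_sub ?leq_subr // !subKn // fdotC.
Qed.

(** One tensor factor of an inner product in (ii), restricted to intermediate degree [d]; it is used
    with [x] equal to minus alpha and [y] equal to beta. *)
Definition yform x y l1 l2 d : F :=
  \sum_(l <- parts d) ymat x l1 l * ymat y l2 l * sqnorm F l.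

Lemma yform_fdot x y l1 l2 d : yform x y l1 l2 d = fdot d (ymode x l1 d) (ymode y l2 d).
Proof.
rewrite /yform /fdot !big_seq; apply: eq_bigr => l.
by rewrite mem_parts => /andP[_ /eqP E]; rewrite /ymat E.
Qed.

(** The coefficient of [x^d] in [x^s (1 - x)^(-g)]. *)
Definition cshift (g : F) d (s : nat) : F := if (s <= d)%N then binc g (d - s) else 0.

(** A matrix element of the normally ordered product: only annihilators act, and the two sides meet
    in degree [e]. The numbers [u] and [w] are the degrees removed by the adjoint of the creation
    part of the opposite operator. *)
Definition gcoef x y l1 l2 e u w : F :=
  fdot e (P y u (P (- x) (sumn l1 - e - u) (basis l1)))
         (P x w (P (- y) (sumn l2 - e - w) (basis l2))).

Lemma fdot_shift e y N k u v : (k <= N)%N ->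
  fdot e v (expX_shift (@cre F) y N k u) =
  if (N - k <= e)%N then fdot (e - (N - k)) (P y (N - k) v) u else 0.
Proof.
move=> le_kN; rewrite /expX_shift le_kN fdotC; case: leqP => h; last exact: fdot_expX_small.
by rewrite fdot_expX_sub // fdotC.
Qed.

Lemma sum_nat_shift e L (H : nat -> F) :
  \sum_(i < L.+1 | (e <= i)%N) H i = if (e <= L)%N then \sum_(u < (L - e).+1) H (e + u)%N else 0.
Proof.
case: leqP => [le_eL|lt_Le]; last first.
  by rewrite big1 // => i; have := ltn_ord i; lia.
rewrite -(big_geq_mkord e _ xpredT) -{1}[e]add0n big_addn subSn // big_mkord.
by apply: eq_bigr => i _; rewrite addnC.
Qed.

(** The creation exponential on the left crosses the pairing as an annihilation exponential, is
    exchanged with the creation exponential on the right, and the latter then crosses back. *)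
Lemma yform_term x y l1 l2 d e1 e2 : (e1 <= d)%N -> (e2 <= d)%N ->
  fdot d (M x (d - e1) (P (- x) (sumn l1 - e1) (basis l1)))
         (M y (d - e2) (P (- y) (sumn l2 - e2) (basis l2)))
  = \sum_(e < (minn e1 e2).+1)
     cshift (x * y) d (e1 + e2 - e) *
      fdot e (P y (e1 - e) (P (- x) (sumn l1 - e1) (basis l1)))
             (P x (e2 - e) (P (- y) (sumn l2 - e2) (basis l2))).
Proof.
move=> le1 le2; rewrite fdot_expX_sub ?leq_subr // subKn //.
rewrite (expX_exchange (@ann_ann F) (@cre_cre F) (@ann_cre F)) fdot_sumr.
set b1 := P (- x) _ _; set b2 := P (- y) _ _.
pose H k := fdot (k + e1 + e2 - d) (P y (d - e2 - k) b1) (P x (d - e1 - k) b2).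
transitivity (\sum_(k < (d - e1).+1 | (k <= d - e2)%N && (d <= k + e1 + e2)%N)
   binc (x * y) k * H k).
  rewrite [RHS]big_mkcond; apply: eq_bigr => k _; rewrite fdotZr.
  case: (leqP k (d - e2)) => [le_k|gt_k] /=; last first.
    by rewrite /expX_shift leqNgt gt_k fdot0r mulr0.
  rewrite fdot_shift //.
  have -> : (d - e2 - k <= e1)%N = (d <= k + e1 + e2)%N by lia.
  case: ifP => h; last by rewrite mulr0.
  by rewrite /H; congr (_ * fdot _ _ _); lia.
rewrite [RHS](bigID (fun e : 'I_ _ => (e1 + e2 - e <= d)%N)) /= [X in _ = _ + X]big1 ?addr0; last first.
  by move=> e /negbTE h; rewrite /cshift h mul0r.
(* Mutually inverse substitutions [k = d + e - e1 - e2] and [e = k + e1 + e2 - d]; the filters keep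
   the truncated subtractions exact. *)
rewrite (reindex_onto (fun e : 'I_(minn e1 e2).+1 => inord (d + e - e1 - e2) : 'I_(d - e1).+1)
                      (fun k : 'I_(d - e1).+1 => inord (k + e1 + e2 - d) : 'I_(minn e1 e2).+1)) /=; last first.
  move=> k; have := ltn_ord k => lt_k /andP[h1 h2]; apply: val_inj.
  rewrite /= inordK inordK; lia.
have valK (e : 'I_(minn e1 e2).+1) : (inord (d + e - e1 - e2) : 'I_(d - e1).+1) = (d + e - e1 - e2)%N :> nat.
  by rewrite inordK //; have := ltn_ord e; lia.
apply: eq_big => [e|e].
  have := ltn_ord e => lt_e; rewrite -val_eqE /= valK inordK; lia.
rewrite -val_eqE /= valK => /andP[/andP[h1 h2]].
have := ltn_ord e => lt_e; rewrite inordK => [/eqP h3|]; last by lia.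
rewrite /cshift ifT; last by lia.
by rewrite /H; congr (binc _ _ * fdot _ _ _); [lia|lia|congr (P _ _ _); lia|congr (P _ _ _); lia].
Qed.

(** The sums over [e1] and [e2] may run past [d], because [cshift] vanishes there; the ranges then
    no longer depend on [d]. *)
Lemma yformE x y l1 l2 d :
  yform x y l1 l2 d =
  \sum_(e < (minn (sumn l1) (sumn l2)).+1) \sum_(u < (sumn l1 - e).+1) \sum_(w < (sumn l2 - e).+1)
    gcoef x y l1 l2 e u w * cshift (x * y) d (e + u + w).
Proof.
pose T e e1 e2 := cshift (x * y) d (e1 + e2 - e) *
      fdot e (P y (e1 - e) (P (- x) (sumn l1 - e1) (basis l1)))
             (P x (e2 - e) (P (- y) (sumn l2 - e2) (basis l2))).
set K := minn (sumn l1) (sumn l2).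
have widen L (H : nat -> F) : (forall e, (d < e)%N -> H e = 0) ->
    \sum_(e < (minn L d).+1) H e = \sum_(e < L.+1) H e.
  move=> H0; rewrite (big_ord_widen L.+1) ?ltnS ?geq_minl // big_mkcond.
  apply: eq_bigr => e _; rewrite ltnS leq_min -ltnS ltn_ord /=.
  by case: leqP => // /H0.
have T0 e e1 e2 : (e <= e1)%N -> (e <= e2)%N -> (d < e1)%N || (d < e2)%N -> T e e1 e2 = 0.
  by move=> h1 h2 h3; rewrite /T /cshift ifF ?mul0r //; lia.
rewrite yform_fdot /ymode fdot_suml.
transitivity (\sum_(e1 < (sumn l1).+1) \sum_(e2 < (sumn l2).+1) \sum_(e < (minn e1 e2).+1) T e e1 e2).
  rewrite -(widen _ (fun e1 => \sum_(e2 < (sumn l2).+1) \sum_(e < (minn e1 e2).+1) T e e1 e2)); last first.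
    move=> e1 lt; apply: big1 => e2 _; apply: big1 => e _.
    by have := ltn_ord e; rewrite ltnS leq_min => /andP[? ?]; apply: T0; rewrite ?lt.
  apply: eq_bigr => e1 _.
  rewrite -(widen _ (fun e2 => \sum_(e < (minn e1 e2).+1) T e e1 e2)); last first.
    move=> e2 lt; apply: big1 => e _.
    by have := ltn_ord e; rewrite ltnS leq_min => /andP[? ?]; apply: T0; rewrite ?lt ?orbT.
  rewrite fdot_sumr; apply: eq_bigr => e2 _; rewrite yform_term //.
    by have := ltn_ord e1; lia.
  by have := ltn_ord e2; lia.
transitivity (\sum_(e1 < (sumn l1).+1) \sum_(e2 < (sumn l2).+1)
    \sum_(e < K.+1 | (e <= e1)%N && (e <= e2)%N) T e e1 e2).
  apply: eq_bigr => e1 _; apply: eq_bigr => e2 _.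
  rewrite (big_ord_widen K.+1 (fun e => T e e1 e2)).
    by apply: eq_bigl => e; rewrite ltnS leq_min.
  by rewrite /K; have := ltn_ord e1; have := ltn_ord e2; lia.
under eq_bigr => e1 _ do rewrite (exchange_big_dep (fun e : 'I_K.+1 => (e <= e1)%N)) => [|? ? ? /andP[]//].
rewrite (exchange_big_dep xpredT) //=; apply: eq_bigr => e _.
have := ltn_ord e; rewrite ltnS leq_min => /andP[he1 he2].
rewrite (eq_bigr (fun e1 : 'I_ _ => \sum_(w < (sumn l2 - e).+1) T e e1 (e + w)%N)); last first.
  move=> e1 h; rewrite (eq_bigl (fun i : 'I_ _ => (e <= i)%N)); last by move=> i; rewrite h.
  by rewrite (sum_nat_shift e _ (fun e2 => T e e1 e2)) he2.
rewrite (sum_nat_shift e _ (fun e1 => \sum_(w < (sumn l2 - e).+1) T e e1 (e + w)%N)) he1.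
apply: eq_bigr => u _; apply: eq_bigr => w _.
rewrite /T /gcoef mulrC !addKn !subnDA; congr (_ * cshift _ _ _); lia.
Qed.

(** On each side the two annihilation exponentials commute and trade their roles. *)
Lemma gcoef_swap x y l1 l2 e u w : (u <= sumn l1 - e)%N -> (w <= sumn l2 - e)%N ->
  gcoef (- y) (- x) l1 l2 e u w = gcoef x y l1 l2 e (sumn l1 - e - u) (sumn l2 - e - w).
Proof.
move=> hu hw; rewrite /gcoef !opprK !subKn // expX_expX; last exact: ann_ann.
by congr fdot; rewrite expX_expX //; exact: ann_ann.
Qed.

Lemma yform_swapE x y l1 l2 d :
  yform (- y) (- x) l1 l2 d =
  \sum_(e < (minn (sumn l1) (sumn l2)).+1) \sum_(u < (sumn l1 - e).+1) \sum_(w < (sumn l2 - e).+1)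
    gcoef x y l1 l2 e u w * cshift (x * y) d (sumn l1 + sumn l2 - (e + u + w)).
Proof.
rewrite yformE mulrNN mulrC; apply: eq_bigr => e _.
have := ltn_ord e; rewrite ltnS leq_min => /andP[he1 he2].
rewrite (reindex_inj rev_ord_inj); apply: eq_bigr => u _.
rewrite (reindex_inj rev_ord_inj); apply: eq_bigr => w _ /=.
have hu := ltn_ord u; have hw := ltn_ord w.
rewrite gcoef_swap; [|lia|lia]; congr (gcoef _ _ _ _ _ _ _ * cshift _ _ _); lia.
Qed.

(** One list serves both orders and all degrees [d]; the bound on the shifts makes their reversal an
    exact subtraction. *)
Lemma yform_expand x y l1 l2 : exists r : seq (F * nat),
  [/\ all (fun g => g.2 <= sumn l1 + sumn l2)%N r,
      forall d, yform x y l1 l2 d = \sum_(g <- r) g.1 * cshift (x * y) d g.2 &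
      forall d, yform (- y) (- x) l1 l2 d =
        \sum_(g <- r) g.1 * cshift (x * y) d (sumn l1 + sumn l2 - g.2)].
Proof.
pose s1 e := index_iota 0 (sumn l1 - e).+1; pose s2 e := index_iota 0 (sumn l2 - e).+1.
pose s0 := index_iota 0 (minn (sumn l1) (sumn l2)).+1.
pose gr e u w := (gcoef x y l1 l2 e u w, (e + u + w)%N).
exists (flatten [seq flatten [seq [seq gr e u w | w <- s2 e] | u <- s1 e] | e <- s0]).
have E (H : F * nat -> F) :
    \sum_(g <- flatten [seq flatten [seq [seq gr e u w | w <- s2 e] | u <- s1 e] | e <- s0]) H g =
    \sum_(e < (minn (sumn l1) (sumn l2)).+1) \sum_(u < (sumn l1 - e).+1)
      \sum_(w < (sumn l2 - e).+1) H (gr e u w).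
  rewrite big_flatten big_map big_mkord; apply: eq_bigr => e _.
  rewrite big_flatten big_map big_mkord; apply: eq_bigr => u _.
  by rewrite big_map big_mkord.
split=> [|d|d]; [|by rewrite E yformE|by rewrite E yform_swapE].
apply/allP => g /flattenP[s /mapP[e He ->]] /flattenP[t /mapP[u Hu ->]] /mapP[w Hw ->] /=.
by move: He Hu Hw; rewrite !mem_index_iota; lia.
Qed.
End MatrixElements.

(** * Autocorrelations of binomial coefficients *)

Section SquareSummable.
Local Open Scope R_scope.
Variables (c : nat -> R) (g : R).
Hypothesis g_lt : Rabs g < / 2.
Hypothesis cS : forall k, c (S k) = c k * (INR k + g) / INR (S k).

(* [k c_k^2] eventually decreases by at least a fixed multiple of [c_k^2] at each step. *)
Lemma sq_summable : ex_series (fun k => c k * c k).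
Proof.
have [g1 g2] := Rabs_def2 _ _ g_lt.
(* The step identity is [k c_k^2 - (k+1) c_(k+1)^2 = c_k^2 (dl k - g^2) / (k + 1)]. The threshold
   [K] is where the last factor reaches [dl / 2]. *)
pose dl := 1 - 2 * g; have dl_gt0 : 0 < dl by rewrite /dl; lra.
have [K HK] := INR_unbounded (1 + 2 * (g * g) / dl).
apply (ex_series_incr_n (fun k => c k * c k) K).
pose a k := c (K + k)%coq_nat * c (K + k)%coq_nat.
pose t k := INR (K + k) * a k.
have a_ge0 k : 0 <= a k by apply: Rle_0_sqr.
have t_ge0 k : 0 <= t k by apply: Rmult_le_pos => //; apply: pos_INR.
have step k : a k <= 2 / dl * (t k - t (S k)).
  rewrite /t /a.
  have -> : (K + k.+1)%coq_nat = S (K + k)%coq_nat by lia.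
  have -> : (K + k.+1)%N = S (K + k)%coq_nat by lia.
  have -> : (K + k)%N = (K + k)%coq_nat by lia.
  rewrite cS; set x := c _.
  have : INR K <= INR (K + k)%coq_nat by apply: le_INR; lia.
  rewrite S_INR; set y := INR (K + k)%coq_nat => Ky.
  have y_gt : 1 + 2 * (g * g) / dl < y by lra.
  have gg : 0 <= 2 * (g * g) / dl.
    by apply: Rmult_le_pos; [nra | apply: Rlt_le; apply: Rinv_0_lt_compat].
  have H1 : 0 <= (dl / 2) * (y - 1) - g * g.
    have -> : (dl / 2) * (y - 1) - g * g = (dl / 2) * (y - (1 + 2 * (g * g) / dl)) by field; lra.
    by apply: Rmult_le_pos; lra.
  have -> : 2 / dl * (y * (x * x) - (y + 1) * (x * (y + g) / (y + 1) * (x * (y + g) / (y + 1)))) =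
     x * x + (x * x) * ((dl / 2) * (y - 1) - g * g) * (2 / dl / (y + 1)).
    by rewrite /dl; field; rewrite -/dl; split; lra.
  have : 0 <= (x * x) * ((dl / 2) * (y - 1) - g * g) * (2 / dl / (y + 1)).
    apply: Rmult_le_pos; first by apply: Rmult_le_pos => //; apply: Rle_0_sqr.
    apply: Rlt_le; apply: Rdiv_lt_0_compat; last by lra.
    by apply: Rdiv_lt_0_compat; lra.
  lra.
have bound n : sum_n a n <= 2 / dl * (t 0%N - t (S n)).
  elim: n => [|n IH]; first by rewrite sum_O; apply: step.
  rewrite sum_Sn /plus /=; have := step (S n); lra.
have [||l Hl] := ex_finite_lim_seq_incr (sum_n a) (2 / dl * t 0%N).
- by move=> n; rewrite sum_Sn /plus /=; have := a_ge0 (S n); lra.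
- move=> n; apply: Rle_trans (bound n) _; apply: Rmult_le_compat_l.
    by apply: Rlt_le; apply: Rdiv_lt_0_compat; lra.
  by have := t_ge0 (S n); lra.
by exists l; apply: Hl.
Qed.

Lemma shift_summable h : ex_series (fun k => c k * c (k + h)%N).
Proof.
have H1 := sq_summable.
have H2 : ex_series (fun k => c (k + h)%N * c (k + h)%N).
  have := proj1 (ex_series_incr_n (fun k => c k * c k) h) H1.
  by apply: ex_series_ext => k; rewrite (_ : (h + k)%coq_nat = (k + h)%N) //; lia.
have := ex_series_plus _ _ H1 H2.
apply: ex_series_le => k; rewrite /plus /norm /= /abs /=.
have := Rle_0_sqr (c k - c (k + h)%N); have := Rle_0_sqr (c k + c (k + h)%N).
rewrite /Rsqr => ? ?; apply: Rabs_le; split; nra.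
Qed.
End SquareSummable.

(** * Double sums over a box and their limits *)

Section Truncation.
Variable g : R.

Definition tail n : R := Series (fun k => Rmult (binc g k) (binc g (k + n)%N)).

(** What a box leaves of an autocorrelation: the degrees of both tensor factors are cut at [N], and
    their difference is fixed. *)
Definition trunc (x y : nat) (D : Z) (N : nat) : R :=
  \sum_(d < N.+1) \sum_(d' < N.+1 | Z.eqb (Z.of_nat d - Z.of_nat d') D)
    cshift g d x * cshift g d' y.

Lemma truncC x y D N : trunc x y D N = trunc y x (- D) N.
Proof.
rewrite /trunc (exchange_big_dep xpredT) //=; apply: eq_bigr => d _.
apply: eq_big => [d'|d' _]; last by rewrite mulrC.
by apply/idP/idP => /Z.eqb_eq h; apply/Z.eqb_eq; lia.
Qed.

(** On the diagonal [d' = k + y] and [d = k + n + x], and both are at most [N]. *)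
Lemma truncE x y n D N : (D - Z.of_nat x + Z.of_nat y = Z.of_nat n)%BZ ->
  trunc x y D N = \sum_(k < N.+1 - maxn y (x + n)) binc g k * binc g (k + n).
Proof.
move=> hD; rewrite /trunc (exchange_big_dep xpredT) //=.
pose H i := if (i - y + n + x <= N)%N then binc g (i - y) * binc g (i - y + n) else 0.
transitivity (\sum_(i < N.+1 | (y <= i)%N) H i).
  rewrite [RHS]big_mkcond; apply: eq_bigr => d' _.
  have [le_y|lt_y] := leqP y d'; last first.
    by apply: big1 => d _; rewrite {2}/cshift leqNgt lt_y mulr0.
  have E (d : nat) : Z.eqb (Z.of_nat d - Z.of_nat d') D = (d == d' - y + n + x)%N.
    by apply/idP/idP => [/Z.eqb_eq h|/eqP h]; [apply/eqP|apply/Z.eqb_eq]; lia.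
  rewrite /H; case: (leqP (d' - y + n + x) N) => h; last first.
    by apply: big1 => d; rewrite E; have := ltn_ord d; lia.
  rewrite (big_pred1 (Ordinal (h : (_ < N.+1)%N))) /= => [|d]; last by rewrite E /= -val_eqE.
  by rewrite /cshift le_y leq_addl addnK mulrC.
rewrite sum_nat_shift; case: leqP => [le_yN|lt_Ny]; last first.
  have -> : (N.+1 - maxn y (x + n) = 0)%N by lia.
  by rewrite big_ord0.
rewrite (big_ord_widen (N - y).+1 (fun k => binc g k * binc g (k + n))); last by lia.
rewrite [RHS]big_mkcond; apply: eq_bigr => u _; rewrite /H addKn.
have := ltn_ord u => lt_u.
by have -> : (u + n + x <= N)%N = (u < N.+1 - maxn y (x + n))%N by lia.
Qed.

Lemma sum_nE (u : nat -> R) N : sum_n u N = \sum_(k < N.+1) u k.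
Proof.
by elim: N => [|N IH]; rewrite ?sum_O ?big_ord1 // sum_Sn big_ord_recr /= IH.
Qed.

Hypothesis g_lt : (Rabs g < / 2)%SR.

Lemma is_lim_trunc x y D :
  is_lim_seq (trunc x y D) (tail (Z.abs_nat (D - Z.of_nat x + Z.of_nat y))).
Proof.
wlog h : x y D / (0 <= D - Z.of_nat x + Z.of_nat y)%BZ => [W|].
  have [h|h] := Z.le_gt_cases 0 (D - Z.of_nat x + Z.of_nat y)%BZ; first exact: W.
  apply: (is_lim_seq_ext (trunc y x (- D))) => [N|]; first by rewrite -truncC.
  have := W y x (- D)%BZ; rewrite (_ : Z.abs_nat _ = Z.abs_nat (D - Z.of_nat x + Z.of_nat y)).
    by apply; lia.
  by lia.
set n := Z.abs_nat _.
have hn : (D - Z.of_nat x + Z.of_nat y = Z.of_nat n)%BZ by rewrite /n; lia.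
(* Shifting [N] by this amount gives genuine partial sums, so [x] and [y] affect the limit only
   through the lag. *)
apply/(is_lim_seq_incr_n _ (maxn y (x + n))).
apply: (is_lim_seq_ext (sum_n (fun k => Rmult (binc g k) (binc g (k + n)%N)))).
  by move=> N; rewrite sum_nE (truncE _ hn) -plusE subSn ?leq_addl // addnK.
apply: Series_correct.
have cS k : binc g (S k) =
    Rdiv (Rmult (binc g k) (Rplus (INR k) g)) (INR (S k)).
  by rewrite !INRE RdivE.
exact: (shift_summable g_lt cS n).
Qed.

Lemma is_lim_seq_big (I : Type) (r : seq I) (u : I -> nat -> R) (l : I -> R) :
  (forall i, is_lim_seq (u i) (l i)) ->
  is_lim_seq (fun N => \sum_(i <- r) u i N) (\sum_(i <- r) l i).
Proof.
move=> ul; elim: r => [|i r IH].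
  by rewrite big_nil; apply: (is_lim_seq_ext (fun=> 0)) => [N|];
    [rewrite big_nil | exact: is_lim_seq_const].
rewrite big_cons; apply: (is_lim_seq_ext (fun N => u i N + \sum_(i <- r) u i N)).
  by move=> N; rewrite big_cons.
exact: is_lim_seq_plus'.
Qed.
End Truncation.

(** * Formal vectors as elements of the Fock space *)

Lemma CplusA : associative Cplus. Proof. exact: Cplus_assoc. Qed.
Lemma CplusC : commutative Cplus. Proof. exact: Cplus_comm. Qed.
Lemma Cplus0 : left_id C0 Cplus. Proof. exact: Cplus_0_l. Qed.
HB.instance Definition _ := Monoid.isComLaw.Build C C0 Cplus CplusA CplusC Cplus0.

Lemma CsumE (I : Type) (r : seq I) (f : I -> C) :
  Csum (map f r) = \big[Cplus/C0]_(i <- r) f i.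
Proof. by rewrite unlock /Csum; elim: r => //= i r ->. Qed.

Lemma Csum_cat u v : Csum (u ++ v) = Cplus (Csum u) (Csum v).
Proof. by elim: u => [|z u IH] /=; rewrite ?Cplus_0_l // IH Cplus_assoc. Qed.

Lemma RtoC_sum (I : Type) (r : seq I) (P : pred I) (f : I -> R) :
  RtoC (\sum_(i <- r | P i) f i)%R = \big[Cplus/C0]_(i <- r | P i) RtoC (f i).
Proof. by apply: (big_morph RtoC) => // x y; rewrite RtoC_plus. Qed.

(** A formal vector may repeat or reorder terms, so only its coefficients are compared. The first
    clause ensures that no term escapes this comparison through another charge or an unsorted
    sequence. *)
Definition represents (v : fvec) (j : Z) (f : fock R) : Prop :=
  all (fun tm => Z.eqb tm.2.1 j && sorted leq tm.2.2) v /\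
  forall l : mset, coef1 v j (val l) = RtoC (f l).

Lemma eq_Csum_all (I : Type) (P : pred I) (F G : I -> C) r :
  all P r -> (forall i, P i -> F i = G i) -> Csum (map F r) = Csum (map G r).
Proof. by move=> + FG; elim: r => //= i r IH /andP[/FG-> /IH->]. Qed.

Lemma Csum_scale (I : Type) (c : C) (F : I -> C) r :
  Csum [seq Cmult c (F i) | i <- r] = Cmult c (Csum (map F r)).
Proof.
elim: r => [|i r IH] /=; first by rewrite /C0 Cmult_0_r.
by rewrite IH Cmult_plus_distr_l.
Qed.

Lemma represents_basis j lam : is_part lam ->
  represents [:: (RtoC 1, (j, lam))] j (basis R lam).
Proof.
move=> plam; split; first by rewrite /= Z.eqb_refl; case/andP: plam => ->.
move=> l; rewrite /coef1 /= Z.eqb_refl /basis -{1}(toM_part plam).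
have -> : (val (toM lam) == val l) = (l == toM lam) by rewrite val_eqE eq_sym.
by case: eqP => _; rewrite Cplus_0_r.
Qed.

Lemma represents_cat u v j f g :
  represents u j f -> represents v j g -> represents (u ++ v) j (f + g)%R.
Proof.
move=> [au uf] [av vg]; split; first by rewrite all_cat au.
by move=> l; rewrite /coef1 map_cat Csum_cat -!/(coef1 _ _ _) uf vg -RtoC_plus.
Qed.

Lemma represents_flatten (I : eqType) (r : seq I) (v : I -> fvec) j (f : I -> fock R) :
  (forall i, i \in r -> represents (v i) j (f i)) ->
  represents (flatten [seq v i | i <- r]) j (\sum_(i <- r) f i)%R.
Proof.
elim: r => [|i r IH] H /=; first by rewrite big_nil; split.
rewrite big_cons; apply: represents_cat; first by apply: H; rewrite inE eqxx.
by apply: IH => k kr; apply: H; rewrite inE kr orbT.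
Qed.

Lemma represents_scale a v j f :
  represents v j f -> represents (scaleV a v) j (a *: f)%R.
Proof.
move=> [av vf]; split; first by rewrite /scaleV all_map.
move=> l; rewrite fctE RtoC_mult -vf /coef1 /scaleV -Csum_scale -map_comp.
congr Csum; apply: eq_map => tm /=; case: ifP => // _.
by rewrite /C0 Cmult_0_r.
Qed.

Lemma sort_eq_rem n t l : sorted leq t -> sorted leq l -> n \in l ->
  (sort leq (n :: t) == l) = (t == rem n l).
Proof.
move=> st sl nl; apply/eqP/eqP => [E|->].
  apply: (sorted_eq leq_trans anti_leq st (subseq_sorted leq_trans (rem_subseq n l) sl)).
  by rewrite -(perm_cons n) -(permPr (perm_to_rem nl)) -E perm_sym perm_sort.
apply: (sorted_eq leq_trans anti_leq _ sl); first exact/sort_sorted/leq_total.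
by rewrite perm_sort perm_sym perm_to_rem.
Qed.

Lemma represents_crea n v j f : represents v j f -> represents (crea n v) j (cre n f).
Proof.
move=> [av vf]; split.
  rewrite /crea all_map; apply: sub_all av => tm /= /andP[-> _] /=.
  exact/sort_sorted/leq_total.
move=> l; rewrite /cre; have sl : sorted leq (val l) := valP l.
case: ifP => nl; last first.
  rewrite /coef1 /crea -map_comp CsumE big1 // => tm _ /=.
  rewrite (_ : (_ == _) = false) ?andbF //; apply: contraFF nl => /eqP E; rewrite -[val l]/(sval l) -E.
  by rewrite mem_sort inE eqxx.
rewrite -vf /coef1 /crea -map_comp; apply: (eq_Csum_all av) => tm /= /andP[_ st].
rewrite (sort_eq_rem st sl nl).
have -> : sort leq (rem n (sval l)) = rem n (sval l) => //.
apply: (sorted_sort leq_trans).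
exact: (subseq_sorted leq_trans (rem_subseq _ _) sl).
Qed.

Lemma represents_anni n v j f : represents v j f -> represents (anni n v) j (ann n f).
Proof.
move=> [av vf]; split.
  rewrite /anni all_map; apply: sub_all av => tm /= /andP[-> st] /=.
  exact: (subseq_sorted leq_trans (rem_subseq _ _) st).
move=> l; rewrite /ann; have sl : sorted leq (val l) := valP l.
rewrite RtoC_mult -vf /coef1 /anni -map_comp -Csum_scale.
apply: (eq_Csum_all av) => tm /= /andP[/Z.eqb_eq-> st]; rewrite Z.eqb_refl /=.
(* If [n] does not occur, [rem] leaves the sequence as it is, but the multiplicity factor is 0. *)
have [nt|nt] := boolP (n \in tm.2.2); last first.
  have -> : (tm.2.2 == sort leq (n :: sval l)) = false.
    by apply/eqP => E; move: nt; rewrite E mem_sort inE eqxx.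
  by rewrite (count_memPn nt) muln0 /= Cmult_0_l /C0 Cmult_0_r; case: ifP.
rewrite [rem n _ == _]eq_sym [in RHS]eq_sym -sort_eq_rem //.
case: eqP => [E|]; last by rewrite /C0 Cmult_0_r.
congr Cmult; congr RtoC; rewrite INRE -E; congr ((n * _)%:R)%R.
by rewrite (permP (permEl (perm_sort leq _))) /= eqxx.
Qed.

Lemma expcoefE x c : expcoef x c = expC (x : R) c.
Proof.
rewrite /expcoef /expC factE INRE; congr Rmult.
by rewrite /expw; elim: c => //= n c ->; rewrite INRE RdivE.
Qed.

Lemma represents_Emin x a v j f :
  represents v j f -> represents (Emin x a v) j (expX (@cre R) x a f).
Proof.
move=> vf; apply: represents_flatten => c _; rewrite expcoefE; apply: represents_scale.
by elim: c => //= n c; apply: represents_crea.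
Qed.

Lemma represents_Eplus x b v j f :
  represents v j f -> represents (Eplus x b v) j (expX (@ann R) (- x)%R b f).
Proof.
move=> vf; apply: represents_flatten => c _; rewrite expcoefE; apply: represents_scale.
by elim: c => //= n c; apply: represents_anni.
Qed.

Lemma represents_shiftc p v j f : represents v j f -> represents (shiftc p v) (j + p)%BZ f.
Proof.
move=> [av vf]; split.
  rewrite /shiftc all_map; apply: sub_all av => tm /= /andP[/Z.eqb_eq-> ->].
  by rewrite Z.eqb_refl.
move=> l; rewrite -vf /coef1 /shiftc -map_comp; congr Csum; apply: eq_map => tm /=.
have -> // : Z.eqb (tm.2.1 + p) (j + p) = Z.eqb tm.2.1 j.
by apply/idP/idP => /Z.eqb_eq h; apply/Z.eqb_eq; lia.
Qed.

Lemma coef1_other v j f i l : represents v j f -> i <> j -> coef1 v i l = C0.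
Proof.
move=> [av _] ij; rewrite /coef1.
rewrite (eq_Csum_all (G := fun=> C0) av) => [|tm /andP[/Z.eqb_eq-> _]].
  by rewrite CsumE big1.
by rewrite (_ : Z.eqb j i = false) //; apply/Z.eqb_neq; lia.
Qed.

(** * The modes of a vertex operator *)

(** Integer degrees let annihilators lower without truncation; in negative degree only 0 is
    homogeneous. *)
Definition homog (D : Z) (f : fock R) :=
  forall l : mset, Z.of_nat (sumn (val l)) <> D -> f l = 0%R.

Lemma homog_sum (I : eqType) (r : seq I) (f : I -> fock R) D :
  (forall i, i \in r -> homog D (f i)) -> homog D (\sum_(i <- r) f i)%R.
Proof.
move=> H l hl; rewrite fct_sumE big1_seq // => i /andP[_ ir].
exact: H.
Qed.

Lemma homog_cre D n f : homog D f -> homog (D + Z.of_nat n) (cre n f).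
Proof.
move=> hf l hl; rewrite /cre; case: ifP => // nl; apply: hf.
rewrite (perm_sumn (val_toM _)); move: hl; rewrite (perm_sumn (perm_to_rem nl)) /=.
by move: (sumn (rem _ _)) => s; lia.
Qed.

Lemma homog_ann D n f : homog D f -> homog (D - Z.of_nat n) (ann n f).
Proof.
move=> hf l hl; rewrite /ann hf ?mulr0 //.
by move: hl; rewrite (perm_sumn (val_toM _)) /=; move: (sumn (sval l)) => s; lia.
Qed.

Lemma homog_expX (X : nat -> {linear fock R -> fock R}) (e : Z) x N D f :
  (forall n D f, homog D f -> homog (D + e * Z.of_nat n) (X n f)) ->
  homog D f -> homog (D + e * Z.of_nat N) (expX X x N f).
Proof.
move=> hX hf; apply: homog_sum => c; rewrite mem_comps => /andP[_ /eqP <-] l hl.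
rewrite fctE (_ : word X f c l = 0%R) ?scaler0 //; apply: (_ : homog _ _) hl.
elim: c => [|n c IH] /=; first by rewrite (_ : (D + e * 0)%BZ = D) //; lia.
have := hX n _ _ IH; congr homog; lia.
Qed.

Lemma homog_basis lam : homog (Z.of_nat (sumn lam)) (basis R lam).
Proof.
move=> l hl; rewrite /basis; case: eqP => // E.
by case: hl; rewrite E (perm_sumn (val_toM _)).
Qed.

Definition yterm (x : R) lam a b : fock R :=
  expX (@cre R) x a (expX (@ann R) (- x)%R b (basis R lam)).

Lemma homog_yterm x lam a b :
  homog (Z.of_nat (sumn lam) - Z.of_nat b + Z.of_nat a) (yterm x lam a b).
Proof.
have := @homog_expX (@cre R) 1 x a (Z.of_nat (sumn lam) + -1 * Z.of_nat b).
rewrite (_ : (_ + 1 * _)%BZ = (Z.of_nat (sumn lam) - Z.of_nat b + Z.of_nat a)%BZ); last by lia.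
apply=> [n D f /(@homog_cre _ n)|]; first by congr homog; lia.
apply: homog_expX; last exact: homog_basis.
by move=> n D f /(@homog_ann _ n); congr homog; lia.
Qed.

(* The only [t] for which [Y_{alpha,t}] has a matrix element from [lam] to [l]. *)
Definition tmode (a0 : R) (p j : Z) (lam l : seq nat) : R :=
  (INR (sumn lam) - INR (sumn l) - (IZR p * a0) ^ 2 / 2 - IZR p * a0 * (IZR j * a0))%SR.

Lemma Int_part_IZR k : Int_part (IZR k) = k.
Proof.
by rewrite -(Int_part_spec (IZR k) k) //; lra.
Qed.

(** The degree left after annihilation is [e = sumn lam - b], and the filter says that it is at most
    [sumn l]. *)
Lemma yterm_sum x lam l (k : Z) : k = (Z.of_nat (sumn l) - Z.of_nat (sumn lam))%BZ ->
  (\sum_(b <- [seq b <- iota 0 (sumn lam).+1 | Z.leb 0 (k + Z.of_nat b)])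
     yterm x lam (Z.to_nat (k + Z.of_nat b)) b)%R = ymode x lam (sumn l).
Proof.
move=> kE; rewrite big_filter -[iota 0 _]/(index_iota 0 (sumn lam).+1) big_mkord.
rewrite (reindex_inj rev_ord_inj) /ymode /=.
rewrite (big_ord_widen (sumn lam).+1 (fun e => yterm x lam (sumn l - e) (sumn lam - e)))
  ?ltnS ?geq_minl //.
apply: eq_big => [e|e _]; have lt_e := ltn_ord e.
  by apply/idP/idP => [/Z.leb_le|] h; [|apply/Z.leb_le]; lia.
by rewrite subSS; congr yterm; lia.
Qed.

Lemma Ycoef1 a0 p t j lam :
  let al := (IZR p * a0)%SR in
  let x := (- t - al ^ 2 / 2 - al * (IZR j * a0))%SR in
  Ycoef a0 p t [:: (RtoC 1, (j, lam))] =
  if Req_dec_T x (IZR (Int_part x)) then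
    shiftc p (flatten [seq Emin al (Z.to_nat (Int_part x + Z.of_nat b))
                             (Eplus al b [:: (RtoC 1, (j, lam))])
                      | b <- [seq b <- iota 0 (sumn lam).+1 | Z.leb 0 (Int_part x + Z.of_nat b)]])
  else [::].
Proof. by move=> al x; rewrite -[RHS]cats0. Qed.

Lemma coef1_Ycoef a0 p t j0 lam j l : is_part lam -> is_part l ->
  coef1 (Ycoef a0 p t [:: (RtoC 1, (j0, lam))]) j l =
  if Req_dec_T t (tmode a0 p j0 lam l) then
    if Z.eqb j (j0 + p) then RtoC (ymat (IZR p * a0)%SR lam l) else C0
  else C0.
Proof.
move=> plam pl; rewrite Ycoef1.
set al := (IZR p * a0)%SR; set x := (- t - _ - _)%SR.
case: (Req_dec_T x (IZR (Int_part x))) => [xk|xk]; last first.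
  case: (Req_dec_T t (tmode a0 p j0 lam l)) => // tE; case: xk.
  have -> : x = IZR (Z.of_nat (sumn l) - Z.of_nat (sumn lam)).
    by rewrite /x tE /tmode minus_IZR -/al -!INR_IZR_INZ; lra.
  by rewrite Int_part_IZR.
set k := Int_part x in xk *.
have R := represents_shiftc p (represents_flatten
   (r := [seq b <- iota 0 (sumn lam).+1 | Z.leb 0 (k + Z.of_nat b)])
   (fun b _ => represents_Emin al (Z.to_nat (k + Z.of_nat b))
     (represents_Eplus al b (represents_basis j0 plam)))).
have [->|jE] := Z.eq_dec j (j0 + p); last first.
  rewrite (coef1_other _ R jE) (_ : Z.eqb _ _ = false); first by case: (Req_dec_T t (tmode a0 p j0 lam l)).
  by apply/Z.eqb_neq.
rewrite Z.eqb_refl -{1}(toM_part pl) (proj2 R).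
have xE : (t = tmode a0 p j0 lam l) <-> k = (Z.of_nat (sumn l) - Z.of_nat (sumn lam))%BZ.
  have E1 : x = (INR (sumn l) - INR (sumn lam) + (tmode a0 p j0 lam l - t))%SR.
    by rewrite /x /tmode -/al; lra.
  split=> h.
    by apply: eq_IZR; rewrite minus_IZR -!INR_IZR_INZ -xk; lra.
  by move: xk; rewrite h minus_IZR -!INR_IZR_INZ; lra.
case: (Req_dec_T t (tmode a0 p j0 lam l)) => h.
  by rewrite /ymat -(yterm_sum al (proj1 xE h)).
(* The exponent is an integer but the mode is the wrong one: every term is homogeneous of a degree
   other than [sumn l]. *)
congr RtoC; rewrite fct_sumE big1_seq // => b.
rewrite mem_filter => /andP[_ /andP[/Z.leb_le kb _]].
apply: (@homog_yterm al lam); rewrite (perm_sumn (val_toM _)) => E.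
by case: h; apply/xE; lia.
Qed.

(** * The adjoint relation *)

Lemma In_mem (T : eqType) (x : T) s : List.In x s <-> x \in s.
Proof.
elim: s => //= y s IH; rewrite inE; split.
  by case=> [->|/IH->]; rewrite ?eqxx ?orbT.
by case/orP => [/eqP->|/IH]; [left|right].
Qed.

Lemma NoDup_uniq (T : eqType) (s : seq T) : List.NoDup s -> uniq s.
Proof.
elim=> //= x t nx _ ->; rewrite andbT; apply/negP => xt; apply: nx.
exact/In_mem.
Qed.

(** [fsumR] sums over an unspecified list covering the support. Enlarging it by all [T i] adds only
    zero terms and lets the sums be exchanged. *)
Lemma fsumR_delta (I : Type) (r : seq I) (T : I -> R) (V : I -> C) :
  fsumR (fun t => Csum [seq if Req_dec_T t (T i) then V i else C0 | i <- r])
  = Csum (map V r).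
Proof.
pose g t := \big[Cplus/C0]_(i <- r) if t == T i then V i else C0.
have -> : (fun t => Csum [seq if Req_dec_T t (T i) then V i else C0 | i <- r]) = g.
  apply: funext => t; rewrite CsumE; apply: eq_bigr => i _.
  by case: Req_dec_T => /= [/eqP->|/eqP/negbTE->].
have cov t : g t <> C0 -> t \in map T r.
  move=> gt; apply/negPn/negP => tr; apply: gt; move: tr; rewrite /g.
  elim: (r) => [|i r' IH] /=; rewrite ?big_nil // inE big_cons negb_or.
  by move=> /andP[/negbTE-> /IH->]; rewrite Cplus_0_l.
rewrite /fsumR; case: ClassicalEpsilon.excluded_middle_informative => [H|H]; last first.
  by case: H; exists (map T r) => t /cov/In_mem.
case: ClassicalEpsilon.constructive_indefinite_description => L0 /= HL.
set L := List.nodup _ _.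
have uL : uniq L by apply: NoDup_uniq; apply: List.NoDup_nodup.
have covL t : t \notin L -> g t = C0.
  move=> tL; apply: contrapT => /HL; rewrite -(List.nodup_In Req_dec_T) => /In_mem.
  by rewrite (negbTE tL).
pose L' := undup (L ++ map T r).
rewrite !CsumE; transitivity (\big[Cplus/C0]_(t <- L') g t).
  rewrite [RHS](bigID (mem L)) /= [X in Cplus _ X]big1 ?Cplus_0_r; last by move=> t /covL.
  have pL : perm_eq [seq t <- L' | t \in L] L.
    apply: uniq_perm => //; first exact/filter_uniq/undup_uniq.
    by move=> t; rewrite mem_filter mem_undup mem_cat; case: (t \in L).
  by rewrite -[RHS]big_filter (perm_big _ pL).
rewrite /g exchange_big /=.
have : all (fun i => T i \in L') r.
  rewrite -(all_map T (mem L')); apply/allP => t tr /=.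
  by rewrite mem_undup mem_cat tr orbT.
elim: (r) => [|i r' IH] /=; first by rewrite !big_nil.
case/andP=> iL' /IH; rewrite !big_cons => ->; congr Cplus.
rewrite (bigD1_seq (T i)) ?undup_uniq //= eqxx big1 ?Cplus_0_r // => t /negbTE->.
by [].
Qed.

(** A matrix element of [Phi]. Each tensor factor forces its own mode; in their difference [s] the
    conformal weight and the charge term cancel, which leaves a condition on degrees. *)
Definition rcoef (a0 : R) (p s : Z) (b : Z * seq nat * seq nat) (j : Z) (l m : seq nat) : R :=
  if Z.eqb j (b.1.1 + p) &&
     Z.eqb s (Z.of_nat (sumn b.1.2) - Z.of_nat (sumn l) - Z.of_nat (sumn b.2) + Z.of_nat (sumn m))
  then (ymat (IZR p * a0)%SR b.1.2 l * ymat (IZR p * a0)%SR b.2 m)%R else 0%R.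

Lemma PhiE a0 p s Psi j l m : inD Psi -> is_part l -> is_part m ->
  Phi a0 p s Psi j l m =
  Csum [seq Cmult tm.1 (RtoC (rcoef a0 p s tm.2 j l m)) | tm <- Psi].
Proof.
move=> dPsi pl pm.
rewrite -(fsumR_delta Psi (fun tm => tmode a0 p tm.2.1.1 tm.2.1.2 l)).
congr fsumR; apply: funext => t; apply: (eq_Csum_all dPsi) => -[c [[j0 lam] mu]] /= /andP[plam pmu].
rewrite !coef1_Ycoef // /rcoef /=.
case: (Req_dec_T t (tmode a0 p j0 lam l)) => tE; last by rewrite /C0 Cmult_0_l Cmult_0_r.
case: Z.eqb; last by rewrite /C0 Cmult_0_l.
have <- : is_left (Req_dec_T (t - IZR s)%SR (tmode a0 p j0 mu m)) =
   Z.eqb s (Z.of_nat (sumn lam) - Z.of_nat (sumn l) - Z.of_nat (sumn mu) + Z.of_nat (sumn m)).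
  apply/idP/idP.
    case: Req_dec_T => // h _; apply/Z.eqb_eq; apply: eq_IZR.
    rewrite plus_IZR !minus_IZR -!INR_IZR_INZ.
    by move: h; rewrite tE /tmode; lra.
  move=> /Z.eqb_eq h; case: Req_dec_T => // -[]; rewrite h.
  by rewrite plus_IZR !minus_IZR -!INR_IZR_INZ tE /tmode; lra.
by case: Req_dec_T => h; rewrite /= ?RtoC_mult // /C0 Cmult_0_r.
Qed.

Lemma znormE l : znorm l = sqnorm R l.
Proof.
rewrite /znorm /sqnorm unlock /=; elim: (undup l) => //= n s ->.
by rewrite RpowE factE !INRE.
Qed.

Lemma Cconj_RtoC r : Cconj (RtoC r) = RtoC r.
Proof. by rewrite /Cconj /RtoC /= Ropp_0. Qed.

Lemma Cconj_sum (I : Type) (r : seq I) (f : I -> C) :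
  Cconj (\big[Cplus/C0]_(i <- r) f i) = \big[Cplus/C0]_(i <- r) Cconj (f i).
Proof.
apply: (big_morph Cconj) => [x y|]; first exact: Cplus_conj.
exact: Cconj_RtoC.
Qed.

Lemma Cmult_suml (I : Type) (r : seq I) (f : I -> C) z :
  Cmult (\big[Cplus/C0]_(i <- r) f i) z = \big[Cplus/C0]_(i <- r) Cmult (f i) z.
Proof.
apply: (big_morph (Cmult ^~ z)) => [x y|]; first exact: Cmult_plus_distr_r.
exact: Cmult_0_l.
Qed.

Lemma Cmult_sumr (I : Type) (r : seq I) (f : I -> C) z :
  Cmult z (\big[Cplus/C0]_(i <- r) f i) = \big[Cplus/C0]_(i <- r) Cmult z (f i).
Proof. by rewrite Cmult_comm Cmult_suml; apply: eq_bigr => i _; rewrite Cmult_comm. Qed.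

Lemma rcoef_adjoint a0 p s b1 b2 :
  is_part b1.1.2 -> is_part b1.2 -> is_part b2.1.2 -> is_part b2.2 ->
  (rcoef a0 p s b2 b1.1.1 b1.1.2 b1.2 * (znorm b1.1.2 * znorm b1.2))%R =
  (rcoef a0 (- p) (- s) b1 b2.1.1 b2.1.2 b2.2 * (znorm b2.1.2 * znorm b2.2))%R.
Proof.
move: b1 b2 => [[j1 l1] m1] [[j2 l2] m2] /= pl1 pm1 pl2 pm2; rewrite /rcoef /= !znormE.
have -> : (Z.eqb j1 (j2 + p) &&
    Z.eqb s (Z.of_nat (sumn l2) - Z.of_nat (sumn l1) - Z.of_nat (sumn m2) + Z.of_nat (sumn m1)))
  = (Z.eqb j2 (j1 + - p) &&
    Z.eqb (- s) (Z.of_nat (sumn l1) - Z.of_nat (sumn l2) - Z.of_nat (sumn m1) + Z.of_nat (sumn m2))).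
  by apply/idP/idP => /andP[/Z.eqb_eq h1 /Z.eqb_eq h2]; apply/andP; split; apply/Z.eqb_eq; lia.
case: ifP => _; last by rewrite !mul0r.
have -> : (IZR (- p) * a0)%SR = (- (IZR p * a0))%R by rewrite opp_IZR -Ropp_mult_distr_l.
by rewrite mulrACA (ymat_adjoint _ pl2) // (ymat_adjoint _ pm2) // -mulrACA.
Qed.

Lemma Phi_adjoint a0 p s Psi1 Psi2 : inD Psi1 -> inD Psi2 ->
  ip_fin_inf Psi1 (Phi a0 p s Psi2) = ip_inf_fin (Phi a0 (- p) (- s) Psi1) Psi2.
Proof.
move=> d1 d2; rewrite /ip_fin_inf /ip_inf_fin.
transitivity (Csum [seq Csum [seq Cmult (Cmult (Cconj t1.1) t2.1)
    (RtoC (rcoef a0 p s t2.2 t1.2.1.1 t1.2.1.2 t1.2.2 * (znorm t1.2.1.2 * znorm t1.2.2))%R)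
    | t2 <- Psi2] | t1 <- Psi1]).
  apply: (eq_Csum_all d1) => t1 /andP[pl pm]; rewrite PhiE // !CsumE.
  rewrite Cmult_sumr Cmult_suml; apply: eq_bigr => t2 _.
  by rewrite [in RHS]RtoC_mult !Cmult_assoc.
transitivity (Csum [seq Csum [seq Cmult (Cmult (Cconj t1.1) t2.1)
    (RtoC (rcoef a0 p s t2.2 t1.2.1.1 t1.2.1.2 t1.2.2 * (znorm t1.2.1.2 * znorm t1.2.2))%R)
    | t1 <- Psi1] | t2 <- Psi2]).
  rewrite !CsumE; under eq_bigr => i _ do rewrite CsumE.
  rewrite exchange_big; apply: eq_bigr => i _; by rewrite CsumE.
apply: (eq_Csum_all d2) => t2 /andP[pl2 pm2]; rewrite PhiE // [in RHS]CsumE Cconj_sum.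
rewrite !Cmult_suml -CsumE; apply: (eq_Csum_all d1) => t1 /andP[pl1 pm1].
rewrite rcoef_adjoint // Cmult_conj Cconj_RtoC [in LHS]RtoC_mult !Cmult_assoc; congr Cmult.
by rewrite -!Cmult_assoc; congr Cmult; rewrite Cmult_comm.
Qed.

(** * Weak commutativity *)

Section Boxes.

Definition boxR (a0 : R) (p q m n : Z) (b1 b2 : Z * seq nat * seq nat) (N : nat) : R :=
  \sum_(j <- charges N) \sum_(l <- parts_le N) \sum_(k <- parts_le N)
    rcoef a0 (- p) (- m) b1 j l k * rcoef a0 q n b2 j l k * (sqnorm R l * sqnorm R k).

Lemma is_part_parts_le N l : l \in parts_le N -> is_part l.
Proof. by move=> /flattenP[s /mapP[d _ ->]]; rewrite mem_parts => /andP[]. Qed.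

Lemma ip_boxE a0 p q m n Psi1 Psi2 N : inD Psi1 -> inD Psi2 ->
  ip_box (Phi a0 (- p) (- m) Psi1) (Phi a0 q n Psi2) N =
  \big[Cplus/C0]_(t1 <- Psi1) \big[Cplus/C0]_(t2 <- Psi2)
    Cmult (Cmult (Cconj t1.1) t2.1) (RtoC (boxR a0 p q m n t1.2 t2.2 N)).
Proof.
move=> d1 d2; rewrite /ip_box.
pose X t1 t2 j l k : C := Cmult (Cmult (Cconj t1.1) t2.1)
  (RtoC (rcoef a0 (- p) (- m) t1.2 j l k * rcoef a0 q n t2.2 j l k * (sqnorm R l * sqnorm R k))).
transitivity (\big[Cplus/C0]_(j <- charges N) \big[Cplus/C0]_(l <- parts_le N)
  \big[Cplus/C0]_(k <- parts_le N) \big[Cplus/C0]_(t1 <- Psi1) \big[Cplus/C0]_(t2 <- Psi2) X t1 t2 j l k).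
  rewrite CsumE; apply: eq_bigr => j _.
  rewrite CsumE !big_seq; apply: eq_bigr => l /is_part_parts_le pl.
  rewrite CsumE !big_seq; apply: eq_bigr => k /is_part_parts_le pk.
  rewrite !PhiE // !CsumE Cconj_sum !Cmult_suml; apply: eq_bigr => t1 _.
  rewrite Cmult_sumr Cmult_suml; apply: eq_bigr => t2 _.
  by rewrite /X Cmult_conj Cconj_RtoC !znormE !RtoC_mult; ring.
under eq_bigr => j _.
  under eq_bigr => l _.
    rewrite exchange_big.
    under eq_bigr => t1 _ do rewrite exchange_big.
    over.
  rewrite exchange_big.
  under eq_bigr => t1 _ do rewrite exchange_big.
  over.
rewrite exchange_big; apply: eq_bigr => t1 _; rewrite exchange_big; apply: eq_bigr => t2 _.
rewrite /boxR RtoC_sum Cmult_sumr; apply: eq_bigr => j _.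
rewrite RtoC_sum Cmult_sumr; apply: eq_bigr => l _.
by rewrite RtoC_sum Cmult_sumr.
Qed.

Lemma sum_charges (G : Z -> R) (J : Z) N : (Z.abs J <= Z.of_nat N)%BZ ->
  (forall j, j <> J -> G j = 0) -> \sum_(j <- charges N) G j = G J.
Proof.
move=> hJ G0; rewrite /charges big_map -[iota 0 _]/(index_iota 0 (N + N).+1) big_mkord.
have lt : (Z.to_nat (J + Z.of_nat N) < (N + N).+1)%N by lia.
rewrite (bigD1 (Ordinal lt)) //= big1 ?addr0; first by congr G; lia.
by move=> i; rewrite -val_eqE /= => h; apply: G0; lia.
Qed.

Lemma sum_parts_le (G : seq nat -> R) N :
  \sum_(l <- parts_le N) G l = \sum_(d < N.+1) \sum_(l <- parts d) G l.
Proof.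
by rewrite /parts_le big_flatten big_map -[iota 0 _]/(index_iota 0 N.+1) big_mkord.
Qed.

(* Both vectors have a common basis vector in their supports only under this condition,
   and then its two partitions differ in size by [box_gap]. *)
Definition box_supp (p q m n : Z) (b1 b2 : Z * seq nat * seq nat) : bool :=
  Z.eqb (b1.1.1 - p) (b2.1.1 + q) &&
  Z.eqb (Z.of_nat (sumn b1.1.2) - Z.of_nat (sumn b1.2) + m)
        (Z.of_nat (sumn b2.1.2) - Z.of_nat (sumn b2.2) - n).

Definition box_gap (n : Z) (b2 : Z * seq nat * seq nat) : Z :=
  (Z.of_nat (sumn b2.1.2) - Z.of_nat (sumn b2.2) - n)%BZ.

(** Once the box contains the only possible charge, the constraints depend on degrees alone, and for
    fixed degrees the sum over pairs of partitions factors. *)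
Lemma boxR_reduce a0 p q m n b1 b2 N : (Z.abs (b2.1.1 + q) <= Z.of_nat N)%BZ ->
  boxR a0 p q m n b1 b2 N =
  if box_supp p q m n b1 b2 then
    \sum_(d < N.+1) \sum_(d' < N.+1 | Z.eqb (Z.of_nat d - Z.of_nat d') (box_gap n b2))
      yform (- (IZR p * a0)) (IZR q * a0) b1.1.2 b2.1.2 d *
      yform (- (IZR p * a0)) (IZR q * a0) b1.2 b2.2 d'
  else 0.
Proof.
move=> hN; rewrite /boxR (@sum_charges _ (b2.1.1 + q)%BZ) //; last first.
  move=> j hj; apply: big1 => l _; apply: big1 => k _.
  rewrite {2}/rcoef (_ : Z.eqb j _ = false) ?mulr0 ?mul0r //.
  by apply/Z.eqb_neq.
have al : (IZR (- p) * a0)%SR = - (IZR p * a0) by rewrite opp_IZR -Ropp_mult_distr_l.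
pose X (d d' : nat) : R := \sum_(l <- parts d) \sum_(k <- parts d')
   rcoef a0 (- p) (- m) b1 (b2.1.1 + q)%BZ l k * rcoef a0 q n b2 (b2.1.1 + q)%BZ l k * (sqnorm R l * sqnorm R k).
transitivity (\sum_(d < N.+1) \sum_(d' < N.+1) X d d').
  rewrite sum_parts_le; apply: eq_bigr => d _.
  by under eq_bigr => l _ do rewrite sum_parts_le; rewrite exchange_big.
have XE (d d' : nat) : X d d' = if box_supp p q m n b1 b2 && Z.eqb (Z.of_nat d - Z.of_nat d') (box_gap n b2)
   then yform (- (IZR p * a0)) (IZR q * a0) b1.1.2 b2.1.2 d *
        yform (- (IZR p * a0)) (IZR q * a0) b1.2 b2.2 d' else 0.
  have E : box_supp p q m n b1 b2 && Z.eqb (Z.of_nat d - Z.of_nat d') (box_gap n b2) =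
    (Z.eqb (b2.1.1 + q) (b1.1.1 + - p) &&
     Z.eqb (- m) (Z.of_nat (sumn b1.1.2) - Z.of_nat d - Z.of_nat (sumn b1.2) + Z.of_nat d'))
    && Z.eqb n (Z.of_nat (sumn b2.1.2) - Z.of_nat d - Z.of_nat (sumn b2.2) + Z.of_nat d').
    rewrite /box_supp /box_gap; apply/idP/idP => /andP[/andP[/Z.eqb_eq h1 /Z.eqb_eq h2] /Z.eqb_eq h3];
    by apply/andP; split; [apply/andP; split|]; apply/Z.eqb_eq; lia.
  rewrite E /X.
  transitivity (\sum_(l <- parts d) \sum_(k <- parts d')
    if (Z.eqb (b2.1.1 + q) (b1.1.1 + - p) &&
        Z.eqb (- m) (Z.of_nat (sumn b1.1.2) - Z.of_nat d - Z.of_nat (sumn b1.2) + Z.of_nat d'))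
    && Z.eqb n (Z.of_nat (sumn b2.1.2) - Z.of_nat d - Z.of_nat (sumn b2.2) + Z.of_nat d')
    then (ymat (- (IZR p * a0)) b1.1.2 l * ymat (IZR q * a0) b2.1.2 l * sqnorm R l) *
         (ymat (- (IZR p * a0)) b1.2 k * ymat (IZR q * a0) b2.2 k * sqnorm R k) else 0).
    rewrite !big_seq; apply: eq_bigr => l; rewrite mem_parts => /andP[_ /eqP sl].
    rewrite !big_seq; apply: eq_bigr => k; rewrite mem_parts => /andP[_ /eqP sk].
    rewrite /rcoef sl sk al Z.eqb_refl /=.
    case: (_ && _); last by rewrite !mul0r.
    case: Z.eqb; last by rewrite mulr0 !mul0r.
    by rewrite [RHS]mulrACA [X in _ = X * _]mulrACA.
  case: ifP => _; last by apply: big1 => l _; apply: big1.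
  by rewrite /yform mulr_suml; apply: eq_bigr => l _; rewrite mulr_sumr.
case: ifP => hs; last first.
  by apply: big1 => d _; apply: big1 => d' _; rewrite XE hs.
apply: eq_bigr => d _; rewrite [RHS]big_mkcond; apply: eq_bigr => d' _.
by rewrite XE hs.
Qed.

(** The maps [s] and [t] are free so that both orders are covered: the identity for one, the
    reversal of shifts for the other. *)
Lemma yform_lim (g : R) (A B : nat -> R) (r1 r2 : seq (R * nat)) (s t : nat -> nat) D :
  Rlt (Rabs g) (/ 2)%SR ->
  (forall d, A d = \sum_(u <- r1) u.1 * cshift g d (s u.2)) ->
  (forall d, B d = \sum_(u <- r2) u.1 * cshift g d (t u.2)) ->
  is_lim_seq (fun N => \sum_(d < N.+1) \sum_(d' < N.+1 | Z.eqb (Z.of_nat d - Z.of_nat d') D) A d * B d')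
    (\sum_(u <- r1) \sum_(v <- r2)
       u.1 * v.1 * tail g (Z.abs_nat (D - Z.of_nat (s u.2) + Z.of_nat (t v.2)))).
Proof.
move=> hg AE BE.
apply: (is_lim_seq_ext (fun N => \sum_(u <- r1) \sum_(v <- r2) u.1 * v.1 * trunc g (s u.2) (t v.2) D N)).
  move=> N; apply/esym.
  under eq_bigr => d _.
    under eq_bigr => d' _.
      rewrite AE BE mulr_suml.
      under eq_bigr => u _ do rewrite mulr_sumr.
      over.
    rewrite exchange_big.
    under eq_bigr => u _ do rewrite exchange_big.
    over.
  rewrite exchange_big; apply: eq_bigr => u _; rewrite exchange_big; apply: eq_bigr => v _.
  rewrite /trunc mulr_sumr; apply: eq_bigr => d _; rewrite mulr_sumr; apply: eq_bigr => d' _.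
  by rewrite mulrACA.
apply: is_lim_seq_big => u; apply: is_lim_seq_big => v.
apply: (is_lim_seq_scal_l _ (u.1 * v.1) (Rbar.Finite _)); exact: is_lim_trunc.
Qed.

Lemma boxR_lim a0 p q m n b1 b2 :
  Rlt (Rabs (IZR p * a0 * (IZR q * a0))) (/ 2)%SR ->
  exists L : R, is_lim_seq (boxR a0 p q m n b1 b2) L /\ is_lim_seq (boxR a0 q p n m b1 b2) L.
Proof.
move=> hg.
have supp_sym : box_supp q p n m b1 b2 = box_supp p q m n b1 b2.
  by rewrite /box_supp; apply/idP/idP => /andP[/Z.eqb_eq h1 /Z.eqb_eq h2];
    apply/andP; split; apply/Z.eqb_eq; lia.
have lim_reduce L (p1 q1 m1 n1 : Z) :
   is_lim_seq (fun N => if box_supp p1 q1 m1 n1 b1 b2 then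
    \sum_(d < N.+1) \sum_(d' < N.+1 | Z.eqb (Z.of_nat d - Z.of_nat d') (box_gap n1 b2))
      yform (- (IZR p1 * a0)) (IZR q1 * a0) b1.1.2 b2.1.2 d *
      yform (- (IZR p1 * a0)) (IZR q1 * a0) b1.2 b2.2 d'
  else 0) L -> is_lim_seq (boxR a0 p1 q1 m1 n1 b1 b2) L.
  apply: is_lim_seq_ext_loc; exists (Z.abs_nat (b2.1.1 + q1)) => N hN.
  by rewrite boxR_reduce //; lia.
have [hs|hs] := boolP (box_supp p q m n b1 b2); last first.
  exists 0; split; apply: lim_reduce; rewrite ?supp_sym (negbTE hs); exact: is_lim_seq_const.
have [r1 [A1 E1 F1]] := yform_expand (- (IZR p * a0)) (IZR q * a0) b1.1.2 b2.1.2.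
have [r2 [A2 E2 F2]] := yform_expand (- (IZR p * a0)) (IZR q * a0) b1.2 b2.2.
have {}hg : Rlt (Rabs (- (IZR p * a0) * (IZR q * a0))) (/ 2)%SR.
  by rewrite -Ropp_mult_distr_l Rabs_Ropp.
have H := yform_lim (s := id) (t := id) (D := box_gap n b2) hg E1 E2.
eexists; split; apply: lim_reduce; rewrite ?supp_sym hs; first exact: H.
rewrite opprK in F1 F2.
have := yform_lim (s := subn (sumn b1.1.2 + sumn b2.1.2))
  (t := subn (sumn b1.2 + sumn b2.2)) (D := box_gap m b2) hg F1 F2.
congr is_lim_seq; congr Rbar.Finite.
have sw (I : eqType) (r : seq I) (P : pred I) (f g : I -> R) : all P r -> (forall i, P i -> f i = g i) ->
  \sum_(i <- r) f i = \sum_(i <- r) g i.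
  by move=> aP fg; rewrite !big_seq; apply: eq_bigr => i /(allP aP)/fg.
apply: (sw _ _ _ _ _ A1) => u hu; apply: (sw _ _ _ _ _ A2) => v hv.
(* By the support condition, [box_gap m b2] is [n] plus the difference of the degrees of the two
   partitions in [b1]. With both shifts reversed the lag is therefore the negative of the other one,
   and [Z.abs_nat] agrees. *)
congr (_ * tail _ _).
move: hs => /andP[_ /Z.eqb_eq hs]; rewrite /box_gap.
by move: hu hv hs => /=; lia.
Qed.
End Boxes.

(** * Passage to complex combinations *)

Lemma filterlim_C (u : nat -> C) (L : C) :
  is_lim_seq (fun N => (u N).1) L.1 -> is_lim_seq (fun N => (u N).2) L.2 ->
  filterlim u eventually (locally L).
Proof.
move=> /filterlim_locally h1 /filterlim_locally h2; apply/filterlim_locally => eps.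
apply: filter_imp (filter_and _ _ (h1 eps) (h2 eps)) => N [b1 b2].
by split.
Qed.

Lemma filterlim_Csum (I : Type) (r : seq I) (z : I -> C) (u : I -> nat -> R) (l : I -> R) :
  (forall i, is_lim_seq (u i) (l i)) ->
  filterlim (fun N => \big[Cplus/C0]_(i <- r) Cmult (z i) (RtoC (u i N))) eventually
    (locally (\big[Cplus/C0]_(i <- r) Cmult (z i) (RtoC (l i)))).
Proof.
move=> ul.
have E1 (x : I -> R) : (\big[Cplus/C0]_(i <- r) Cmult (z i) (RtoC (x i))).1 = (\sum_(i <- r) (z i).1 * x i)%R.
  rewrite (big_morph (fun w : C => w.1) (id1 := 0%R) (op1 := +%R)) //.
  by apply: eq_bigr => i _ /=; rewrite Rmult_0_r Rminus_0_r.
have E2 (x : I -> R) : (\big[Cplus/C0]_(i <- r) Cmult (z i) (RtoC (x i))).2 = (\sum_(i <- r) (z i).2 * x i)%R.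
  rewrite (big_morph (fun w : C => w.2) (id1 := 0%R) (op1 := +%R)) //.
  by apply: eq_bigr => i _ /=; rewrite Rmult_0_r Rplus_0_l.
apply: filterlim_C.
  rewrite E1; apply: is_lim_seq_ext => [N|]; first by rewrite E1.
  by apply: is_lim_seq_big => i; apply: (is_lim_seq_scal_l _ _ (Rbar.Finite _)).
rewrite E2; apply: is_lim_seq_ext => [N|]; first by rewrite E2.
by apply: is_lim_seq_big => i; apply: (is_lim_seq_scal_l _ _ (Rbar.Finite _)).
Qed.

Lemma mul_lt_half x y : Rlt (Rabs x) (/ sqrt 2)%SR -> Rlt (Rabs y) (/ sqrt 2)%SR ->
  Rlt (Rabs (x * y)%SR) (/ 2)%SR.
Proof.
move=> hx hy; rewrite Rabs_mult.
have -> : (/ 2 = / sqrt 2 * / sqrt 2)%SR.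
  by rewrite -Rinv_mult sqrt_sqrt //; lra.
by apply: Rmult_le_0_lt_compat => //; apply: Rabs_pos.
Qed.

Lemma Phi_commute a0 p q m n Psi1 Psi2 :
  Rlt (Rabs (IZR p * a0)) (/ sqrt 2)%SR -> Rlt (Rabs (IZR q * a0)) (/ sqrt 2)%SR ->
  inD Psi1 -> inD Psi2 ->
  exists L : C,
    ip_inf_is (Phi a0 (- p) (- m) Psi1) (Phi a0 q n Psi2) L /\
    ip_inf_is (Phi a0 (- q) (- n) Psi1) (Phi a0 p m Psi2) L.
Proof.
move=> hp hq d1 d2.
pose lim (t : (C * (Z * seq nat * seq nat)) * (C * (Z * seq nat * seq nat))) :=
  cid (boxR_lim m n t.1.2 t.2.2 (mul_lt_half hp hq)).
pose r := allpairs Datatypes.pair Psi1 Psi2.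
pose z (t : (C * (Z * seq nat * seq nat)) * (C * (Z * seq nat * seq nat))) := Cmult (Cconj t.1.1) t.2.1.
exists (\big[Cplus/C0]_(t <- r) Cmult (z t) (RtoC (sval (lim t)))).
have E p' q' m' n' N : ip_box (Phi a0 (- p') (- m') Psi1) (Phi a0 q' n' Psi2) N =
   \big[Cplus/C0]_(t <- r) Cmult (z t) (RtoC (boxR a0 p' q' m' n' t.1.2 t.2.2 N)).
  by rewrite ip_boxE // /r big_allpairs.
rewrite /ip_inf_is !(funext (E _ _ _ _)); split; apply: filterlim_Csum => t.
  exact: (proj1 (svalP (lim t))).
exact: (proj2 (svalP (lim t))).
Qed.

Open Scope R_scope.

(* alpha = p * alpha0, beta = q * alpha0 *)
Theorem mainTheorem4 (a0 : R) (p q : Z) :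
  0 < Rabs a0 <= 1 ->
  Rabs (IZR p * a0) < / sqrt 2 ->
  Rabs (IZR q * a0) < / sqrt 2 ->
  (forall (s : Z) (Psi1 Psi2 : tvec), inD Psi1 -> inD Psi2 ->
     ip_fin_inf Psi1 (Phi a0 p s Psi2) = ip_inf_fin (Phi a0 (- p) (- s) Psi1) Psi2) /\
  (forall (m n : Z) (Psi1 Psi2 : tvec), inD Psi1 -> inD Psi2 ->
     exists L : C,
       ip_inf_is (Phi a0 (- p) (- m) Psi1) (Phi a0 q n Psi2) L /\
       ip_inf_is (Phi a0 (- q) (- n) Psi1) (Phi a0 p m Psi2) L).
Proof.
move=> _ hp hq; split=> [s|m n] Psi1 Psi2 d1 d2; first exact: Phi_adjoint.
exact: Phi_commute.
Qed.
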